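(* Let $K\ge 2$, let $(p_{ij})_{i,j\in\Sigma}$ be the transition matrix of an irreducible, aperiodic Markov chain on $\Sigma=\{1,\dots,K\}$, let $\alpha\in(0,1)$, and set $j=j(m)=m^{\alpha}$. Then $$\lim_{m\to\infty}\frac{1}{\ln(m)}H_{m,j(m)}=(1-\alpha)\,C^*\qquad\text{almost surely,}$$ where $C^*=\lim_{\theta\to\infty}\frac{\rho(\theta)}{-\rho'(\theta)}$.
   Context: Boxes: they are indexed by words $u\in\bigcup_{n\ge0}\Sigma^n$. At generation $0$ there is one box $b_\emptyset$ of size $1$ and type $1$. A box $b_u$ of generation $n$ and type $i$ is split at generation $n+1$ into sub-boxes $b_{uk}$, $k\in\Sigma$, where $b_{uk}$ has type $k$ and size $|b_{uk}|=|b_u|\,p_{ik}$. Balls: an infinite sequence of balls is thrown successively and independently; each ball starts in $b_\emptyset$ and, when in a box $b_u$, falls at the next generation into $b_{uk}$ with probability $|b_{uk}|/|b_u|$ (so the types visited by each ball form an independent copy of the Markov chain started from $1$). For a real number $j>0$, $H_{m,j}$ is the first generation at which all boxes contain strictly less than $j$ balls when the first $m$ balls have been thrown. For $\theta\in\mathbb R$, $A(\theta)=(p_{ij}^{\theta})_{i,j\in\Sigma}$ with the convention $p_{ij}^\theta=0$ if $p_{ij}=0$ (even for $\theta\le0$), and $\rho(\theta)$ is the maximum modulus (Perron–Frobenius) eigenvalue of $A(\theta)$; it is an analytic function of $\theta$ and $\ln\rho$ is convex. *)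

(* Defs.v *)
From HB Require Import structures.
From mathcomp Require Import all_boot all_order all_algebra.
From mathcomp Require Import complex.
From mathcomp Require Import all_classical all_reals all_analysis.

Set Implicit Arguments.
Unset Strict Implicit.
Unset Printing Implicit Defensive.

Import Order.TTheory GRing.Theory Num.Theory.
Import numFieldNormedType.Exports.

Local Open Scope classical_set_scope.
Local Open Scope ring_scope.

Definition stochastic (R : realType) (K : nat) (p : 'M[R]_K) : Prop :=
  (forall i j, 0 <= p i j) /\ (forall i, \sum_j p i j = 1).

Definition irreducible_chain (R : realType) (K : nat) (p : 'M[R]_K) : Prop :=
  forall i j, exists n : nat, 0 < (p ^+ n) i j.

(* gcd {n >= 1 | (p ^+ n) i i > 0} = 1 for every state i: 1 is the only common
   divisor of the possible return times. *)
Definition aperiodic_chain (R : realType) (K : nat) (p : 'M[R]_K) : Prop :=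
  forall (i : 'I_K) (d : nat),
    (forall n : nat, (0 < n)%N -> 0 < (p ^+ n) i i -> (d %| n)%N) -> d = 1%N.

(* The test is needed because powR has 0 `^ 0 = 1. *)
Definition powmx (R : realType) (K : nat) (p : 'M[R]_K) (theta : R) : 'M[R]_K :=
  \matrix_(i, j) (if p i j == 0 then 0 else p i j `^ theta).

Definition max_modulus_eigenvalue (R : realType) (K : nat) (A : 'M[R]_K)
    (r : R) : Prop :=
  eigenvalue A r /\
  forall z : R[i], eigenvalue (map_mx (real_complex R) A) z ->
    ComplexField.Normc.normc z <= r.

(* At most one real r satisfies max_modulus_eigenvalue (powmx p theta) r, and by
   the Perron-Frobenius theorem one does when p has nonnegative entries and
   K > 0; the default value 0 of xget is not used then. *)
Definition rho (R : realType) (K : nat) (p : 'M[R]_K) (theta : R) : R :=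
  xget 0 [set r | max_modulus_eigenvalue (powmx p theta) r].

(* A box is a word u; root is the type of the initial box [::], so that
   last root u is the type of the box u. *)
Fixpoint box_size (R : realType) (K : nat) (p : 'M[R]_K) (root : 'I_K)
    (u : seq 'I_K) : R :=
  if u is k :: v then p root k * box_size p k v else 1.

Lemma box_size_rcons (R : realType) (K : nat) (p : 'M[R]_K) (root : 'I_K)
    (u : seq 'I_K) (k : 'I_K) :
  box_size p root (rcons u k) = box_size p root u * p (last root u) k.
Proof.
elim: u root => [|l u IHu] root /=; first by rewrite mulr1 mul1r.
by rewrite IHu mulrA.
Qed.

(* fall b n t is the letter k such that the ball b, in a box u at generation n,
   is in the box rcons u k at generation n.+1. *)
Definition box_of (T : Type) (K : nat) (fall : nat -> nat -> T -> 'I_K)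
    (b n : nat) (t : T) : seq 'I_K :=
  mkseq (fun k => fall b k t) n.

Definition trajectory_events (T : Type) (K : nat)
    (fall : nat -> nat -> T -> 'I_K) (b : nat) : set (set T) :=
  <<s [set E | exists n k, E = [set t | fall b n t = k]] >>.

Definition mutually_independent (d : measure_display) (T : measurableType d)
    (R : realType) (P : probability T R) (F : nat -> set (set T)) : Prop :=
  forall (J : seq nat) (E : nat -> set T), uniq J ->
    (forall b, b \in J -> F b (E b)) ->
    P (\bigcap_(b in [set` J]) E b) = (\prod_(b <- J) P (E b))%E.

(* The second clause is the conditional law of a fall; it is written
   multiplicatively since a box of size 0 contains a ball with probability 0. *)
Definition ball_process (d : measure_display) (T : measurableType d)
    (R : realType) (P : probability T R) (K : nat) (p : 'M[R]_K) (root : 'I_K)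
    (fall : nat -> nat -> T -> 'I_K) : Prop :=
  [/\ forall b n k, measurable [set t | fall b n t = k],
      forall b (u : seq 'I_K) (k : 'I_K),
        P [set t | box_of fall b (size u).+1 t = rcons u k] =
        (P [set t | box_of fall b (size u) t = u] *
         (box_size p root (rcons u k) / box_size p root u)%:E)%E
    & mutually_independent P (trajectory_events fall)].

Definition occupancy (T : Type) (K : nat) (fall : nat -> nat -> T -> 'I_K)
    (m n : nat) (u : seq 'I_K) (t : T) : nat :=
  #|[pred b : 'I_m | box_of fall b n t == u]|.

(* H_{m,j}, equal to +oo when no generation qualifies (e.g. m = j = 1). *)
Definition H (R : realType) (T : Type) (K : nat)
    (fall : nat -> nat -> T -> 'I_K) (m : nat) (j : R) (t : T) : \bar R :=
  ereal_inf [set (n%:R)%:E | n in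
    [set n : nat | forall u : n.-tuple 'I_K, (occupancy fall m n u t)%:R < j]].

(* Main.v *)
Require Import Defs.
From HB Require Import structures.
From mathcomp Require Import all_boot all_order all_algebra.
From mathcomp Require Import complex ring lra.
From mathcomp Require Import all_classical all_reals all_analysis.

Import Order.TTheory GRing.Theory Num.Theory.
Import numFieldNormedType.Exports.

Local Open Scope classical_set_scope.
Local Open Scope ring_scope.

(* Let [A(theta) = powmx p theta]. The height is governed by the size of the
   largest box of generation [n], which is [exp (gam * n + o(n))], where [gam] is
   the limit of [(ln rho)'] at infinity: with [r] a positive right eigenvector of
   [A(theta)], every word [u] starting at [i] satisfies
   [|b_u|^theta * r_last <= rho^n * r_i], and the greedy word satisfies the reverse
   inequality with [rho / K] in place of [rho]; the factor [K] disappears after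
   dividing logarithms by [theta -> oo]. Hence [C^* = -1 / gam], and [gam < 0]
   because an aperiodic irreducible chain has no deterministic path of length [K].

   The derivative of [ln rho] is handled through its convexity: Gibbs' inequality
   exhibits [g(theta) = sum l_i A_ij ln p_ij r_j / (rho * l . r)] as a subgradient of
   [ln rho], and [g] is continuous because the normalised Perron vectors are.

   A box of size [s] receives at least [j] balls with probability at most
   ['C(m, j) * s^j] (union bound over sets of [j] balls), and fewer than [j] balls
   with probability at most [j * (1 - s)^(m / j)] (one of [j] blocks of balls misses
   it). Just above, respectively below, the generation [(1 - alpha) * C^* * ln m]
   these bounds are summable in [m], and the Borel-Cantelli lemma applies. *)

(** * Perron-Frobenius theory *)

Lemma finite_lower_bound (R : realType) (I : finType) (a : I -> R) :
  (forall i, 0 < a i) -> exists2 e, 0 < e & forall i, e <= a i.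
Proof.
move=> a0; exists (\big[Num.min/1]_i a i); last by move=> i; exact: bigmin_le_cond.
by elim/big_ind: _ => // x y x0 y0; rewrite lt_min x0.
Qed.

Lemma finite_upper_bound (R : realType) (I : finType) (a : I -> R) :
  exists2 e, 0 < e & forall i, a i <= e.
Proof.
exists (\big[Num.max/1]_i a i); last by move=> i; exact: le_bigmax_cond.
by apply: lt_le_trans (bigmax_ge_id _ _ _ _).
Qed.

Lemma cvg_sumr (R : realType) (I : finType) (T : Type) (F : set_system T)
    (f : I -> T -> R) (a : I -> R) {FF : Filter F} :
  (forall i, f i x @[x --> F] --> a i) ->
  \sum_i f i x @[x --> F] --> \sum_i a i.
Proof. by move=> fa; apply: cvg_big => // z; exact: add_continuous. Qed.

Lemma cvg_sumr0 (R : realType) (I : finType) (T : Type) (F : set_system T)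
    (f : I -> T -> R) {FF : Filter F} :
  (forall i, f i x @[x --> F] --> 0) -> \sum_i f i x @[x --> F] --> 0.
Proof.
by move=> /(@cvg_sumr _ _ _ _ f (fun=> 0)); rewrite [X in _ --> X]big1.
Qed.

Lemma cvg_dist0 (R : realType) (T : Type) (F : set_system T) (f : T -> R) (a : R)
    {FF : Filter F} : f x @[x --> F] --> a -> `|f x - a| @[x --> F] --> 0.
Proof. by move=> /subr_cvg0/cvg_norm; rewrite normr0. Qed.

Section Perron.
Context {R : realType} {K : nat}.
Implicit Types (A B : 'M[R]_K) (x y : 'rV[R]_K).

Definition nonneg_mx A := forall i j, 0 <= A i j.

Lemma nonneg_mxX A n : nonneg_mx A -> nonneg_mx (A ^+ n).
Proof.
move=> A0; elim: n => [|n IHn] i j; first by rewrite expr0 mxE ler0n.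
by rewrite exprS mxE sumr_ge0// => k _; rewrite mulr_ge0.
Qed.

Lemma mulmx_gt0 x B : (forall i, 0 <= x 0 i) -> x != 0 ->
  (forall i j, 0 < B i j) -> forall j, 0 < (x *m B) 0 j.
Proof.
move=> x0 xN0 B0 j; rewrite mxE.
have [i xi] : exists i, x 0 i != 0.
  apply: contrapT => /forallNP xz; move/eqP: xN0; apply; apply/rowP => i.
  by rewrite mxE; apply/eqP/negPn/negP; exact: xz.
rewrite (bigD1 i)//= ltr_wpDr//.
  by apply: sumr_ge0 => k _; rewrite mulr_ge0// ltW.
by rewrite mulr_gt0// lt_neqAle eq_sym xi x0.
Qed.

(** Summing, over all pairs of states, a power of [A] that joins the pair gives a positive matrix.
    It makes nonzero nonnegative vectors positive in every coordinate, and commuting with [A] it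
    preserves eigenvector relations. *)
Lemma irreducible_pos_comm A : nonneg_mx A -> irreducible_chain A ->
  exists2 n : 'I_K -> 'I_K -> nat,
    (forall k l, 0 < (\sum_i \sum_j A ^+ n i j) k l) &
    comm_mx A (\sum_i \sum_j A ^+ n i j).
Proof.
move=> A0 /(_ _)/(_ _)/cid Airr; exists (fun i j => sval (Airr i j)).
  move=> k l; rewrite summxE (bigD1 k)//= summxE (bigD1 l)//= -addrA ltr_wpDr//.
    rewrite addr_ge0// ?sumr_ge0// => i _; first exact: nonneg_mxX.
    by rewrite summxE sumr_ge0// => j _; exact: nonneg_mxX.
  exact: svalP (Airr k l).
apply: comm_mx_sum => i _; apply: comm_mx_sum => j _.
exact: (commrX _ (commr_refl A)).
Qed.

(** Collatz-Wielandt: the pairs [(lam, x)] with [x] in the simplex and [lam * x <= x *m A] form a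
    compact set, on which the first projection attains its maximum. *)
Lemma perron_maximizer (hK : (0 < K)%N) A : nonneg_mx A ->
  exists lam : R, exists x, [/\ 0 <= lam, (forall i, 0 <= x 0 i), x != 0,
     (forall j, lam * x 0 j <= (x *m A) 0 j) &
     forall mu y, (forall i, 0 <= y 0 i) -> y != 0 ->
       (forall j, mu * y 0 j <= (y *m A) 0 j) -> mu <= lam].
Proof.
move=> A0; pose M := \sum_i \sum_j A i j.
pose S := [set z : R * 'rV[R]_K | [/\ `[0, M]%classic z.1,
  (forall i, `[0, 1]%classic (z.2 0 i)), \sum_i z.2 0 i = 1 &
  forall j, 0 <= (z.2 *m A) 0 j - z.1 * z.2 0 j]].
have coord i : continuous (fun z : R * 'rV[R]_K => z.2 0 i).
  move=> z; apply: (@continuous_comp _ _ _ snd (fun v : 'rV[R]_K => v 0 i)).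
    exact: cvg_snd.
  exact: coord_continuous.
have Scompact : compact S.
  pose C := (`[0, M]%classic `*` [set v : 'rV[R]_K | forall i, `[0, 1]%classic (v 0 i)]).
  apply: (@subclosed_compact _ _ C).
  - pose X := (R * 'rV[R]_K)%type.
    have -> : S = ((fst : X -> R) @^-1` `[0, M]%classic) `&`
        (\bigcap_i [set z : X | `[0, 1]%classic (z.2 0 i)]) `&`
        ((fun z : X => \sum_i z.2 0 i) @^-1` [set 1]) `&`
        \bigcap_j ((fun z : X => (z.2 *m A) 0 j - z.1 * z.2 0 j)
                     @^-1` [set u | 0 <= u]).
      apply/seteqP; split => [z [z1 z2 z3 z4]|z [[[z1 z2] z3] z4]].
        by split; [split=> //; split=> // i _; exact: z2|move=> j _; exact: z4].
      by split => //; [move=> i; exact: z2|move=> j; exact: z4].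
    apply: closedI; last first.
      apply: closed_bigI => j _.
      under eq_fun do rewrite mxE.
      apply: closed_comp; last exact: closed_ge.
      move=> z _; apply: cvgB.
        by apply: cvg_sumr => i; apply: cvgM; [exact: coord|exact: cvg_cst].
      by apply: cvgM; [exact: cvg_fst|exact: coord].
    apply: closedI; last first.
      apply: closed_comp; last exact: closed_eq.
      by move=> z _; apply: cvg_sumr => i; exact: coord.
    apply: closedI.
      by apply: closed_comp; [move=> z _; exact: cvg_fst|exact: itv_closed].
    apply: closed_bigI => i _.
    apply: (@closed_comp _ _ (fun z : R * 'rV[R]_K => z.2 0 i) `[0, 1]%classic).
      by move=> z _; exact: coord.
    exact: itv_closed.
  - apply: compact_setX; first exact: segment_compact.
    have := @rV_compact R K (fun=> `[0, 1]%classic).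
    by rewrite (ord1 ord0); apply => _; exact: segment_compact.
  - by move=> z [].
(* Rescaling [y] to coordinate sum 1 lands in [S]; the bound [mu <= M] follows by summing the
   inequalities over [j]. *)
have normalize mu y : (forall i, 0 <= y 0 i) -> y != 0 -> 0 <= mu ->
    (forall j, mu * y 0 j <= (y *m A) 0 j) -> exists v, S (mu, v).
  move=> y0 yN0 mu0 hy; pose s := \sum_i y 0 i.
  have s0 : 0 < s.
    have := mulmx_gt0 _ (const_mx 1) y0 yN0 (fun i j => _) (Ordinal hK).
    rewrite mxE; under eq_bigr do rewrite mxE mulr1.
    by apply => i j; rewrite mxE.
  have v0 i : 0 <= (s^-1 *: y) 0 i by rewrite mxE mulr_ge0// invr_ge0 ltW.
  have v1 : \sum_i (s^-1 *: y) 0 i = 1.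
    by under eq_bigr do rewrite mxE; rewrite -mulr_sumr mulVf// gt_eqF.
  have vle i : (s^-1 *: y) 0 i <= 1.
    by rewrite -v1 (bigD1 i)//= lerDl sumr_ge0.
  have hv j : mu * (s^-1 *: y) 0 j <= ((s^-1 *: y) *m A) 0 j.
    rewrite -scalemxAl !mxE mulrCA ler_pM2l ?invr_gt0//.
    by have := hy j; rewrite [X in _ <= X -> _]mxE.
  exists (s^-1 *: y); split => //=.
  - rewrite in_itv/= mu0/= -(mulr1 mu) -v1 mulr_sumr.
    apply: (le_trans (ler_sum _ (fun j _ => hv j))).
    rewrite /M exchange_big/=; apply: ler_sum => j _; rewrite mxE.
    apply: ler_sum => i _; apply: (le_trans (ler_wpM2r _ (vle i))) => //.
    by rewrite mul1r.
  - by move=> i; rewrite in_itv/= v0 vle.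
  - by move=> j; rewrite subr_ge0.
have S0 : S !=set0.
  have [||||v Sv] := normalize 0 (const_mx 1); last by exists (0, v).
  - by move=> i; rewrite mxE.
  - apply/eqP => /rowP/(_ (Ordinal hK)); rewrite !mxE => /eqP.
    by rewrite oner_eq0.
  - by [].
  - move=> j; rewrite mul0r mxE sumr_ge0// => i _.
    by rewrite mulr_ge0// mxE.
have [|[lam x] + lam_max] := @compact_EVT_max _ R fst S S0 Scompact.
  by apply: continuous_subspaceT => z; exact: cvg_fst.
rewrite inE => -[/= + x01 xs hx]; rewrite in_itv/= => /andP[lam0 _].
exists lam, x; split => //.
- by move=> i; have := x01 i; rewrite in_itv/= => /andP[].
- apply/eqP => x0; move: xs; rewrite x0; under eq_bigr do rewrite mxE.
  by rewrite big1// => /esym/eqP; rewrite oner_eq0.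
- by move=> j; rewrite -subr_ge0.
- move=> mu y y0 yN0 hy; have [mu0|/ltW mu0] := leP 0 mu; last exact: le_trans lam0.
  by have [v Sv] := normalize mu y y0 yN0 mu0 hy; have := lam_max (mu, v); apply; rewrite inE.
Qed.

(** Applying the positive combination of powers of [A] to [x] gives a positive vector that is also a
    multiple of [x], so [x] has no zero coordinate. *)
Lemma nonneg_eigenvector_gt0 A (lam : R) x : nonneg_mx A -> irreducible_chain A ->
  (forall i, 0 <= x 0 i) -> x != 0 -> x *m A = lam *: x -> forall i, 0 < x 0 i.
Proof.
move=> A0 Airr x0 xN0 xA i.
have [n B0 _] := irreducible_pos_comm A A0 Airr.
have xAX k : x *m A ^+ k = lam ^+ k *: x.
  elim: k => [|k IHk]; first by rewrite !expr0 mulmx1 scale1r.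
  by rewrite !exprSr mulmxA IHk -scalemxAl xA scalerA.
have xB : x *m (\sum_i \sum_j A ^+ n i j) = (\sum_i \sum_j lam ^+ n i j) *: x.
  rewrite mulmx_sumr scaler_suml; apply: eq_bigr => k _.
  by rewrite mulmx_sumr scaler_suml; apply: eq_bigr => j _.
rewrite lt_neqAle x0 andbT; apply/eqP => xi.
by have := mulmx_gt0 _ _ x0 xN0 B0 i; rewrite xB mxE -xi mulr0 ltxx.
Qed.

(** The maximizer is an eigenvector: otherwise multiplying by [B] makes the slack
    [x *m A - lam *: x] positive in every coordinate, and [x *m B] would admit some [lam + e]. *)
Lemma perron_left (hK : (1 < K)%N) A : nonneg_mx A -> irreducible_chain A ->
  exists lam : R, exists x, [/\ 0 < lam, (forall i, 0 < x 0 i) & x *m A = lam *: x].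
Proof.
move=> A0 Airr; have [lam [x [lam0 x0 xN0 hx xmax]]] := perron_maximizer (ltnW hK) _ A0.
have [n B0 BA] := irreducible_pos_comm A A0 Airr.
set B := (\sum_i _) in B0 BA.
have xB0 := mulmx_gt0 _ _ x0 xN0 B0.
have xA : x *m A = lam *: x.
  apply: contrapT => /eqP xAN.
  pose w := x *m A - lam *: x.
  have w0 i : 0 <= w 0 i by rewrite !mxE subr_ge0; have := hx i; rewrite mxE.
  have wN0 : w != 0 by rewrite subr_eq0.
  have wB0 := mulmx_gt0 _ _ w0 wN0 B0.
  have wB : w *m B = x *m B *m A - lam *: (x *m B).
    by rewrite mulmxBl -scalemxAl -!mulmxA BA.
  have [e e0 he] : exists2 e, 0 < e & forall i, e <= (w *m B) 0 i / (x *m B) 0 i.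
    by apply: finite_lower_bound => i; rewrite divr_gt0.
  have : lam + e <= lam.
    apply: (xmax _ (x *m B)).
    - by move=> i; exact: ltW.
    - apply/eqP => /rowP/(_ (Ordinal (ltnW hK))) /eqP; rewrite [X in _ == X]mxE.
      by rewrite gt_eqF.
    - move=> j; rewrite mulrDl -lerBrDl; apply: (@le_trans _ _ ((w *m B) 0 j)).
        by rewrite -ler_pdivlMr.
      by rewrite wB !mxE.
  by rewrite gerDl leNgt e0.
have xpos := nonneg_eigenvector_gt0 _ _ _ A0 Airr x0 xN0 xA.
(* Since [x] is positive, [lam = 0] would force [A = 0], which cannot join two distinct states;
   these exist as [1 < K]. *)
exists lam, x; split => //; rewrite lt_neqAle lam0 andbT; apply/eqP => lamz.
have Az i j : A i j = 0.
  have /rowP/(_ j) := xA; rewrite -lamz scale0r !mxE => /eqP.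
  rewrite psumr_eq0; last by move=> k _; rewrite mulr_ge0// ltW.
  by move/allP/(_ i); rewrite mem_index_enum mulf_eq0 gt_eqF//= => /(_ isT)/eqP.
have [[|k]] := Airr (Ordinal (ltnW hK)) (Ordinal hK).
  by rewrite expr0 mxE ltxx.
by rewrite exprS mxE big1 ?ltxx// => j _; rewrite Az mul0r.
Qed.

Lemma irreducible_tr A : irreducible_chain A -> irreducible_chain A^T.
Proof.
move=> Airr i j; have [n] := Airr j i; exists n.
suff -> : A^T ^+ n = (A ^+ n)^T by rewrite mxE.
elim: n {p} => [|n IHn]; first by rewrite !expr0 trmx1.
by rewrite exprS IHn exprSr trmx_mul.
Qed.

Lemma perron_right (hK : (1 < K)%N) A : nonneg_mx A -> irreducible_chain A ->
  exists lam : R, exists y : 'cV[R]_K,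
    [/\ 0 < lam, (forall i, 0 < y i 0) & A *m y = lam *: y].
Proof.
move=> A0 Airr.
have [] := perron_left hK A^T; first by move=> i j; rewrite mxE.
  exact: irreducible_tr.
move=> lam [x [lam0 x0 xA]]; exists lam, x^T; split => //.
  by move=> i; rewrite mxE.
by apply: trmx_inj; rewrite trmx_mul trmxK xA linearZ/= trmxK.
Qed.

Lemma mulmx_row_col_gt0 (hK : (0 < K)%N) x (y : 'cV[R]_K) : (forall i, 0 < x 0 i) ->
  (forall i, 0 < y i 0) -> 0 < (x *m y) 0 0.
Proof.
move=> x0 y0; rewrite mxE (bigD1 (Ordinal hK))//= ltr_wpDr ?mulr_gt0//.
by apply: sumr_ge0 => i _; rewrite mulr_ge0// ltW.
Qed.

(** The left and right eigenvalues agree because [x *m A *m y] can be evaluated from either side and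
    [x *m y] is positive. *)
Lemma perron_pair (hK : (1 < K)%N) A : nonneg_mx A -> irreducible_chain A ->
  exists lam : R, exists x, exists y : 'cV[R]_K,
    [/\ 0 < lam, (forall i, 0 < x 0 i), (forall i, 0 < y i 0),
      x *m A = lam *: x & A *m y = lam *: y].
Proof.
move=> A0 Airr; have [lam [x [lam0 x0 xA]]] := perron_left hK A A0 Airr.
have [mu [y [mu0 y0 Ay]]] := perron_right hK A A0 Airr.
exists lam, x, y; split => //.
suff -> : lam = mu by [].
have : lam *: (x *m y) = mu *: (x *m y).
  by rewrite scalemxAl -xA -mulmxA Ay -scalemxAr.
move=> /matrixP/(_ 0 0); rewrite [LHS]mxE [RHS]mxE; apply: mulIf.
by rewrite gt_eqF// mulmx_row_col_gt0// ltnW.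
Qed.

(** For a complex eigenvector [v], the triangle inequality bounds [|z| |v_j|] by the sum of
    [|v_i| A_ij]; weighting by the right eigenvector [y] and summing over [j] turns this into
    [|z| <= lam]. *)
Lemma perron_max_modulus A (lam : R) x (y : 'cV[R]_K) : nonneg_mx A ->
  0 < lam -> (forall i, 0 < x 0 i) -> (forall i, 0 < y i 0) ->
  x *m A = lam *: x -> A *m y = lam *: y -> x != 0 ->
  max_modulus_eigenvalue A lam.
Proof.
move=> A0 lam0 x0 y0 xA Ay xN0; split; first by apply/eigenvalueP; exists x.
move=> z /eigenvalueP[v vA vN0].
pose c k := ComplexField.Normc.normc (v 0 k).
have c0 k : 0 <= c k by rewrite /c; case: (v 0 k) => a b; exact: sqrtr_ge0.
have cz : 0 < \sum_j c j * y j 0.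
  have [j vj] : exists j, v 0 j != 0.
    apply: contrapT => /forallNP xz; move/eqP: vN0; apply; apply/rowP => i.
    by rewrite mxE; apply/eqP/negPn/negP; exact: xz.
  rewrite (bigD1 j)//= ltr_wpDr//.
    by apply: sumr_ge0 => i _; rewrite mulr_ge0// ltW.
  rewrite mulr_gt0// lt_neqAle c0 andbT eq_sym.
  by apply: contra vj => /eqP/ComplexField.Normc.eq0_normc ->.
rewrite -(ler_pM2r cz) mulr_sumr.
have le j : ComplexField.Normc.normc z * (c j * y j 0) <=
    \sum_i c i * A i j * y j 0.
  rewrite mulrA -mulr_suml ler_wpM2r ?(ltW (y0 j))//.
  have /rowP/(_ j) := vA; rewrite !mxE => vAj.
  rewrite -ComplexField.Normc.normcM -vAj.
  apply: (@le_trans _ _ (\sum_i ComplexField.Normc.normc (v 0 i * (A i j)%:C%C))).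
    under eq_bigr do rewrite [map_mx _ _ _ _]mxE.
    elim/big_ind2: _ => // [|a b a' b' ab ab'].
      by rewrite ComplexField.Normc.normc0.
    by apply: (le_trans (le_normcD _ _)); exact: lerD.
  apply: ler_sum => i _; rewrite ComplexField.Normc.normcM.
  by rewrite /= expr0n addr0 sqrtr_sqr ger0_norm.
apply: (le_trans (ler_sum _ (fun j _ => le j))).
rewrite exchange_big/= mulr_sumr; apply: ler_sum => i _.
under eq_bigr do rewrite -mulrA.
rewrite -mulr_sumr mulrCA; have /colP/(_ i) := Ay; rewrite !mxE => ->.
by rewrite lexx.
Qed.

End Perron.

Section PerronSimple.
Context {R : realType} {K : nat}.
Implicit Types (A B : 'M[R]_K) (x v : 'rV[R]_K) (y : 'cV[R]_K).

(** Each of the two numbers is also a complex eigenvalue, hence bounded by the other. This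
    identifies the value of [xget] in [rho] with the Perron root. *)
Lemma max_modulus_eigenvalue_inj A (r s : R) :
  max_modulus_eigenvalue A r -> max_modulus_eigenvalue A s -> r = s.
Proof.
have le u w : max_modulus_eigenvalue A u -> max_modulus_eigenvalue A w -> u <= w.
  move=> [Au _] [_ /(_ u%:C%C)].
  rewrite eigenvalue_map => /(_ Au)/=; rewrite expr0n addr0 sqrtr_sqr.
  by apply: le_trans; exact: ler_norm.
by move=> Ar As; apply/eqP; rewrite eq_le !le.
Qed.

(* Subtracting from [v] the largest multiple of [x] below it leaves a nonnegative
   eigenvector with a zero entry. *)
Lemma perron_eigenline A (lam : R) x v : nonneg_mx A -> irreducible_chain A ->
  (forall i, 0 < x 0 i) -> x *m A = lam *: x -> v *m A = lam *: v ->
  exists c, v = c *: x.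
Proof.
move=> A0 Airr x0 xA vA.
have [i0|noI] := pickP (@predT 'I_K); last first.
  by exists 0; apply/rowP => i; have := noI i.
move=> _; case: (@arg_minP _ _ _ i0 predT (fun i => v 0 i / x 0 i)) => // i _ imin.
pose c := v 0 i / x 0 i; exists c; apply/eqP; rewrite -subr_eq0.
apply: contrapT => /negP wN0.
have : 0 < (v - c *: x) 0 i.
  apply: (@nonneg_eigenvector_gt0 _ _ A lam) => //.
    by move=> j; rewrite !mxE subr_ge0 -ler_pdivlMr// imin.
  by rewrite mulmxBl -scalemxAl vA xA scalerBr !scalerA mulrC.
by rewrite !mxE divfK ?subrr ?ltxx// gt_eqF.
Qed.

(** The rank-one term removes the kernel of [lam%:M - A]: if [v] is killed, multiplying by [y] gives
    [v *m y = 0], so [v] is an eigenvector, hence a multiple of [x], and that multiple is 0 because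
    [x *m y] is positive. *)
Lemma perron_shift_unit (hK : (0 < K)%N) A (lam : R) x y : nonneg_mx A ->
  irreducible_chain A -> (forall i, 0 < x 0 i) -> (forall i, 0 < y i 0) ->
  x *m A = lam *: x -> A *m y = lam *: y -> lam%:M - A + y *m x \in unitmx.
Proof.
move=> A0 Airr x0 y0 xA Ay; rewrite unitmxE unitfE; apply/det0P => -[v vN0].
have xy0 : (x *m y) 0 0 != 0 by rewrite gt_eqF// mulmx_row_col_gt0.
rewrite mulmxDr mulmxBr mul_mx_scalar mulmxA => vB.
have vy : v *m y = 0.
  have /(congr1 (fun w => w *m y)) := vB.
  rewrite mul0mx mulmxDl mulmxBl -scalemxAl -(mulmxA v A) Ay -scalemxAr subrr add0r.
  rewrite -(mulmxA (v *m y) x y) => /matrixP/(_ 0 0); rewrite [LHS]mxE [RHS]mxE big_ord1 => /eqP.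
  rewrite mulf_eq0 (negbTE xy0) orbF => /eqP vy.
  by apply/matrixP => i j; rewrite !ord1 vy mxE.
move: vB; rewrite vy mul0mx addr0 => /eqP; rewrite subr_eq0 => /eqP/esym vA.
have [c vc] := perron_eigenline A lam x v A0 Airr x0 xA vA.
move: vy; rewrite vc -scalemxAl => /matrixP/(_ 0 0); rewrite [RHS]mxE [LHS]mxE.
move=> /eqP; rewrite mulf_eq0 (negbTE xy0) orbF => /eqP c0.
by move: vN0; rewrite vc c0 scale0r eqxx.
Qed.

(** With [B] the invertible shift, [x t - x0 = x t *m D t *m invmx B], where [D t] tends to 0 and
    the normalisation against [y0] keeps [x t] bounded. *)
Lemma perron_left_cvg (hK : (0 < K)%N) A0 (lam0 : R) x0 y0 (T : Type)
    (F : set_system T) {FF : Filter F} (A : T -> 'M[R]_K) (lam : T -> R)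
    (x : T -> 'rV[R]_K) :
  nonneg_mx A0 -> irreducible_chain A0 -> (forall i, 0 < x0 0 i) ->
  (forall i, 0 < y0 i 0) -> x0 *m A0 = lam0 *: x0 -> A0 *m y0 = lam0 *: y0 ->
  (x0 *m y0) 0 0 = 1 ->
  (forall i j, A t i j @[t --> F] --> A0 i j) -> (lam @ F --> lam0) ->
  (forall t i, 0 < x t 0 i) -> (forall t, x t *m A t = lam t *: x t) ->
  (forall t, (x t *m y0) 0 0 = 1) -> forall j, x t 0 j @[t --> F] --> x0 0 j.
Proof.
move=> A00 A0irr x00 y00 x0A A0y x0y cA clam xpos xA xy j.
pose B := lam0%:M - A0 + y0 *m x0.
have Bu : B \in unitmx by exact: perron_shift_unit.
pose D t := (lam0 - lam t)%:M - (A0 - A t).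
have mulB v : (v *m y0) 0 0 = 1 -> v *m B = v *m (lam0%:M - A0) + x0.
  move=> vy; rewrite mulmxDr mulmxA; congr (_ + _).
  apply/rowP => i; rewrite mxE big_ord1.
  by rewrite vy mul1r.
have xE t : x t = x0 + x t *m (D t *m invmx B).
  have x0B : x0 *m B = x0.
    by rewrite mulB// mulmxBr x0A mul_mx_scalar subrr add0r.
  rewrite -[in LHS](mulmxK Bu (x t)) mulB// mulmxDl addrC.
  congr (_ + _); first by rewrite -[in LHS]x0B mulmxK.
  rewrite mulmxA; congr (_ *m _).
  rewrite /D !mulmxBr !mul_mx_scalar xA scalerBl; apply/rowP => i.
  by rewrite !mxE; ring.
have xle t i : `|x t 0 i| <= (y0 i 0)^-1.
  rewrite gtr0_norm// -[leRHS]mul1r ler_pdivlMr// -(xy t) mxE (bigD1 i)//= lerDl.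
  by rewrite sumr_ge0// => k _; rewrite mulr_ge0// ltW.
have e0 i k : (D t *m invmx B) i k @[t --> F] --> (0 : R).
  rewrite (_ : (fun t => _) = fun t => \sum_l D t i l * invmx B l k); last first.
    by apply/funext => t; rewrite mxE.
  apply: cvg_sumr0 => l; rewrite -[X in _ --> X](mul0r (invmx B l k)).
  apply: cvgM; last exact: cvg_cst.
  have -> : 0 = (lam0 - lam0) *+ (i == l) - (A0 i l - A0 i l).
    by rewrite !subrr mul0rn subr0.
  rewrite (_ : (fun t => _) = fun t => (lam0 - lam t) *+ (i == l) - (A0 i l - A t i l)).
    apply: cvgB; last by apply: cvgB; [exact: cvg_cst|exact: cA].
    case: (i == l) => /=; last exact: cvg_cst.
    by apply: cvgB => //; exact: cvg_cst.
  by apply/funext => t; rewrite !mxE.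
rewrite (_ : (fun t => _) = fun t => x0 0 j + (x t *m (D t *m invmx B)) 0 j); last first.
  by apply/funext => t; rewrite {1}xE mxE.
rewrite -[X in _ --> X]addr0; apply: cvgD; first exact: cvg_cst.
apply: norm_cvg0.
apply: (@squeeze_cvgr _ _ _ _ (fun=> 0) (fun t => \sum_i (y0 i 0)^-1 *
    `|(D t *m invmx B) i j|)).
- apply: nearW => t; rewrite normr_ge0/= [X in `|X|]mxE.
  apply: (le_trans (ler_norm_sum _ _ _)); apply: ler_sum => i _.
  by rewrite normrM ler_wpM2r.
- exact: cvg_cst.
- apply: cvg_sumr0 => i; rewrite -[X in _ --> X](mulr0 (y0 i 0)^-1).
  apply: cvgM; first exact: cvg_cst.
  by rewrite -[X in _ --> X](normr0 R); exact: cvg_norm (e0 i j).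
Qed.

(* [1 + u <= expR u] with [u := t * L i j + ln (y' j / y j) - ln (y' i / y i) +
   ln lam - ln lam'], weighted by [x i * A i j * y j]; the terms in [y' / y]
   telescope because both marginals of the weights are [lam * x i * y i]. *)
Lemma perron_gibbs A A' (L : 'I_K -> 'I_K -> R) (t lam lam' : R) x y y' :
  nonneg_mx A -> (forall i j, A' i j = A i j * expR (t * L i j)) ->
  0 < lam -> 0 < lam' -> (forall i, 0 < x 0 i) -> (forall i, 0 < y i 0) ->
  (forall i, 0 < y' i 0) ->
  x *m A = lam *: x -> A *m y = lam *: y -> A' *m y' = lam' *: y' ->
  t * (\sum_i \sum_j x 0 i * A i j * L i j * y j 0) <=
    (ln lam' - ln lam) * (lam * \sum_i x 0 i * y i 0).
Proof.
move=> A0 A'E lam0 lam'0 x0 y0 y'0 xA Ay A'y'.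
pose h i := ln (y' i 0) - ln (y i 0).
pose W i j := x 0 i * A i j * y j 0.
have W0 i j : 0 <= W i j by rewrite !mulr_ge0// ltW.
have Wr i : \sum_j W i j = lam * (x 0 i * y i 0).
  have /colP/(_ i) := Ay; rewrite !mxE => e.
  by under eq_bigr do rewrite /W -mulrA; rewrite -mulr_sumr e mulrCA.
have Wc j : \sum_i W i j = lam * (x 0 j * y j 0).
  have /rowP/(_ j) := xA; rewrite !mxE => e.
  by rewrite -mulr_suml e mulrA.
have key i j : W i j * (1 + (t * L i j + h j - h i + ln lam - ln lam')) <=
    x 0 i * y i 0 * (lam / lam') / y' i 0 * (A' i j * y' j 0).
  apply: (le_trans (ler_wpM2l (W0 i j) (expR_ge1Dx _))).
  rewrite /h !(expRD, expRN) !lnK ?posrE// A'E /W le_eqVlt; apply/orP; left.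
  apply/eqP.
  by field; rewrite !gt_eqF.
have sumW : \sum_i \sum_j W i j = lam * \sum_i x 0 i * y i 0.
  by rewrite mulr_sumr; apply: eq_bigr.
have : \sum_i \sum_j W i j * (1 + (t * L i j + h j - h i + ln lam - ln lam')) <=
    \sum_i \sum_j x 0 i * y i 0 * (lam / lam') / y' i 0 * (A' i j * y' j 0).
  by apply: ler_sum => i _; apply: ler_sum => j _.
have -> : \sum_i \sum_j x 0 i * y i 0 * (lam / lam') / y' i 0 * (A' i j * y' j 0)
    = lam * \sum_i x 0 i * y i 0.
  rewrite mulr_sumr; apply: eq_bigr => i _; rewrite -mulr_sumr.
  have /colP/(_ i) := A'y'; rewrite !mxE => ->.
  by field; rewrite !gt_eqF.
have -> : \sum_i \sum_j W i j * (1 + (t * L i j + h j - h i + ln lam - ln lam')) =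
    (1 + ln lam - ln lam') * (\sum_i \sum_j W i j) +
    t * (\sum_i \sum_j x 0 i * A i j * L i j * y j 0) +
    (\sum_j \sum_i W i j * h j - \sum_i \sum_j W i j * h i).
  rewrite [\sum_j \sum_i _ * h j]exchange_big/= !mulr_sumr -sumrB -!big_split/=.
  apply: eq_bigr => i _; rewrite !mulr_sumr -sumrB -!big_split/=.
  by apply: eq_bigr => j _; rewrite /W; ring.
have -> : \sum_j \sum_i W i j * h j = \sum_i \sum_j W i j * h i.
  by apply: eq_bigr => i _; rewrite -mulr_suml Wc -mulr_suml Wr.
by rewrite sumW subrr addr0; nra.
Qed.

End PerronSimple.

(** * The spectral radius of [powmx p theta] *)

Lemma irreducible_support (R : realType) (K : nat) (A B : 'M[R]_K) :
  nonneg_mx A -> nonneg_mx B -> (forall i j, 0 < A i j -> 0 < B i j) ->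
  irreducible_chain A -> irreducible_chain B.
Proof.
move=> A0 B0 AB Airr i j; have [n] := Airr i j; exists n.
elim: n i j p => [|n IHn] i j; first by rewrite !expr0.
rewrite !exprS !mxE => Apos.
have [k Ak] : exists k, 0 < A i k * (A ^+ n) k j.
  apply: contrapT => /forallNP Ak; move: Apos; rewrite ltNge => /negP; apply.
  by apply: sumr_le0 => k _; rewrite leNgt; apply/negP.
have Ank : 0 < (A ^+ n) k j.
  rewrite lt_neqAle nonneg_mxX// andbT; apply/eqP => e.
  by move: Ak; rewrite -e mulr0 ltxx.
move: Ak; rewrite (pmulr_lgt0 _ Ank) => Aik.
rewrite (bigD1 k)//= ltr_wpDr ?mulr_gt0 ?AB// ?IHn//.
by apply: sumr_ge0 => l _; rewrite mulr_ge0// nonneg_mxX.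
Qed.

Section PowMx.
Context {R : realType} {K : nat} {p : 'M[R]_K}.
Hypothesis p0 : nonneg_mx p.

Lemma powmx_ge0 theta : nonneg_mx (powmx p theta).
Proof. by move=> i j; rewrite mxE; case: ifP => // _; exact: powR_ge0. Qed.

(** The exponential tilt required by [perron_gibbs]; where [p i j = 0] both sides vanish, whatever
    the default value of [ln 0]. *)
Lemma powmx_shift theta s i j :
  powmx p s i j = powmx p theta i j * expR ((s - theta) * ln (p i j)).
Proof.
rewrite !mxE; have [_|pN0] := eqVneq (p i j) 0; first by rewrite mul0r.
by rewrite /powR (negbTE pN0) -expRD; congr expR; ring.
Qed.

Lemma powmx_cvg theta i j : powmx p s i j @[s --> theta] --> powmx p theta i j.
Proof.
have -> : (fun s => powmx p s i j) =
    (fun s => powmx p theta i j * expR ((s - theta) * ln (p i j))).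
  by apply/funext => s; exact: powmx_shift.
rewrite [X in _ --> X](powmx_shift theta theta); apply: cvgM; first exact: cvg_cst.
apply: (@cvg_comp _ _ _ (fun s => (s - theta) * ln (p i j)) expR _
  (nbhs ((theta - theta) * ln (p i j)))); last exact: continuous_expR.
by apply: cvgM; [apply: cvgB; [exact: cvg_id|exact: cvg_cst]|exact: cvg_cst].
Qed.

Lemma powmx_irreducible theta : irreducible_chain p ->
  irreducible_chain (powmx p theta).
Proof.
apply: irreducible_support => //; first exact: powmx_ge0.
by move=> i j pij; rewrite mxE gt_eqF// powR_gt0.
Qed.

Hypothesis hK : (1 < K)%N.
Hypothesis p_irr : irreducible_chain p.

Lemma perron_family : exists l : R -> 'rV[R]_K, exists r : R -> 'cV[R]_K,
  forall theta, [/\ 0 < rho p theta, (forall i, 0 < l theta 0 i),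
    (forall i, 0 < r theta i 0),
    l theta *m powmx p theta = rho p theta *: l theta &
    powmx p theta *m r theta = rho p theta *: r theta].
Proof.
have H theta : {lr : 'rV[R]_K * 'cV[R]_K | [/\ 0 < rho p theta, (forall i, 0 < lr.1 0 i),
    (forall i, 0 < lr.2 i 0),
    lr.1 *m powmx p theta = rho p theta *: lr.1 &
    powmx p theta *m lr.2 = rho p theta *: lr.2]}.
  apply: cid; have [lam [l [r [lam0 l0 r0 lA Ar]]]] :=
    perron_pair hK _ (powmx_ge0 theta) (powmx_irreducible theta p_irr).
  have lN0 : l != 0.
    apply/eqP => /rowP/(_ (Ordinal (ltnW hK))) /eqP; rewrite [X in _ == X]mxE.
    by rewrite gt_eqF.
  have lamP := perron_max_modulus _ _ _ _ (powmx_ge0 theta) lam0 l0 r0 lA Ar lN0.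
  have -> : rho p theta = lam.
    by apply: xget_unique => // z zP; exact: max_modulus_eigenvalue_inj zP lamP.
  by exists (l, r).
by exists (fun t => (sval (H t)).1), (fun t => (sval (H t)).2) => t; exact: svalP (H t).
Qed.

Lemma ln_rho_subgradient : exists g : R -> R,
  [/\ continuous g,
    (forall theta s, (s - theta) * g theta <= ln (rho p s) - ln (rho p theta)) &
    exists G, forall theta, `|g theta| <= G].
Proof.
have [l [r lrP]] := perron_family.
pose D theta := \sum_i l theta 0 i * r theta i 0.
have D0 theta : 0 < D theta.
  have [_ l0 r0 _ _] := lrP theta.
  by have := mulmx_row_col_gt0 (ltnW hK) _ _ l0 r0; rewrite mxE.
pose N theta := \sum_i \sum_j l theta 0 i * powmx p theta i j * ln (p i j) * r theta j 0.
pose g theta := N theta / (rho p theta * D theta).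
have rho0 theta : 0 < rho p theta by have [] := lrP theta.
have sub theta s : (s - theta) * g theta <= ln (rho p s) - ln (rho p theta).
  have [lam0 l0 r0 lA Ar] := lrP theta; have [lam0' _ r0' _ Ar'] := lrP s.
  rewrite /g mulrA (ler_pdivrMr _ _ (mulr_gt0 (rho0 theta) (D0 theta))).
  exact: (perron_gibbs _ _ (fun i j => ln (p i j)) (s - theta) _ _ _ _ _
    (powmx_ge0 theta) (powmx_shift theta s) lam0 lam0' l0 r0 r0' lA Ar Ar').
(* Each weight [l_i A_ij r_j] is one term of a sum equal to [rho * D], so the quotient weighting
   [ln (p i j)] is at most 1. *)
have gG theta : `|g theta| <= \sum_i \sum_j `|ln (p i j)|.
  have [lam0 l0 r0 lA Ar] := lrP theta.
  have rD0 : 0 < rho p theta * D theta by rewrite mulr_gt0.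
  rewrite /g normrM normfV (gtr0_norm rD0) ler_pdivrMr// mulr_suml.
  apply: (le_trans (ler_norm_sum _ _ _)); apply: ler_sum => i _.
  rewrite mulr_suml; apply: (le_trans (ler_norm_sum _ _ _)); apply: ler_sum => j _.
  rewrite mulrAC normrM mulrC ler_wpM2l// ger0_norm; last first.
    by rewrite !mulr_ge0 ?powmx_ge0// ltW.
  rewrite -mulrA; apply: (@le_trans _ _ (l theta 0 i * (rho p theta * r theta i 0))).
    rewrite ler_pM2l//; have /colP/(_ i) := Ar; rewrite !mxE => <-.
    rewrite (bigD1 j)//= mxE lerDl sumr_ge0// => k _.
    by rewrite mulr_ge0 ?powmx_ge0// ltW.
  rewrite mulrCA ler_pM2l// /D (bigD1 i)//= lerDl sumr_ge0// => k _.
  by rewrite mulr_ge0// ltW.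
exists g; split => //; last by eexists.
move=> th0.
(* The subgradient inequality at both ends and the bound on [g] make [ln rho] Lipschitz; continuity
   of [rho] is an input to the convergence of the eigenvectors. *)
have lip s : `|ln (rho p s) - ln (rho p th0)| <= `|s - th0| * \sum_i \sum_j `|ln (p i j)|.
  have h1 := sub th0 s; have h2 := sub s th0.
  rewrite ler_norml; apply/andP; split.
    apply: le_trans h1; rewrite lerNl -mulrN.
    apply: (le_trans (ler_norm _)); rewrite normrM ler_wpM2l// normrN.
    exact: gG.
  rewrite -opprB lerNl; apply: le_trans h2; rewrite lerNl -mulNr opprB.
  by apply: (le_trans (ler_norm _)); rewrite normrM ler_wpM2l.
have lnrho_cvg : ln (rho p s) @[s --> th0] --> ln (rho p th0).
  apply: cvg_zero; apply: norm_cvg0.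
  apply: (@squeeze_cvgr _ _ _ _ (fun=> 0)
      (fun s => `|s - th0| * \sum_i \sum_j `|ln (p i j)|)).
  - by apply: nearW => s; rewrite normr_ge0 lip.
  - exact: cvg_cst.
  - rewrite -[X in _ --> X](mul0r (\sum_i \sum_j `|ln (p i j)|)).
    apply: cvgM; last exact: cvg_cst.
    by apply: cvg_dist0; exact: cvg_id.
have rho_cvg : rho p s @[s --> th0] --> rho p th0.
  have rhoE s : rho p s = expR (ln (rho p s)) by rewrite lnK// posrE.
  have H : expR (ln (rho p s)) @[s --> th0] --> expR (ln (rho p th0)).
    apply: (@cvg_comp _ _ _ (fun s => ln (rho p s)) expR _
      (nbhs (ln (rho p th0)))).
      exact: lnrho_cvg.
    exact: continuous_expR.
  rewrite [X in _ --> X]rhoE; apply: cvg_trans H; apply: near_eq_cvg.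
  by apply: nearW => s; exact/esym/rhoE.
(* The eigenvectors chosen at different [s] have unrelated scales. They are normalised against fixed
   vectors at [th0], as [perron_left_cvg] requires. *)
pose a s := (l s *m r th0) 0 0.
pose lh s := (a s)^-1 *: l s.
have a0 s : 0 < a s.
  have [_ ls0 _ _ _] := lrP s; have [_ _ r00 _ _] := lrP th0.
  exact: mulmx_row_col_gt0 (ltnW hK) _ _ ls0 r00.
pose b s := (lh th0 *m r s) 0 0.
pose rh s := (b s)^-1 *: r s.
have lh0 s i : 0 < lh s 0 i.
  by have [_ ls0 _ _ _] := lrP s; rewrite mxE mulr_gt0 ?invr_gt0.
have b0 s : 0 < b s.
  have [_ _ r0 _ _] := lrP s; exact: mulmx_row_col_gt0 (ltnW hK) _ _ (lh0 th0) r0.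
have rh0 s i : 0 < rh s i 0.
  by have [_ _ rs0 _ _] := lrP s; rewrite mxE mulr_gt0 ?invr_gt0.
have lh1 s : (lh s *m r th0) 0 0 = 1.
  by rewrite -scalemxAl mxE mulVf// gt_eqF.
have rh1 s : (lh th0 *m rh s) 0 0 = 1.
  by rewrite -scalemxAr mxE mulVf// gt_eqF.
have lhA s : lh s *m powmx p s = rho p s *: lh s.
  by have [_ _ _ lA _] := lrP s; rewrite -scalemxAl lA !scalerA mulrC.
have rhA s : powmx p s *m rh s = rho p s *: rh s.
  by have [_ _ _ _ Ar] := lrP s; rewrite -scalemxAr Ar !scalerA mulrC.
have b1 : b th0 = 1 by exact: lh1.
have rhth : rh th0 = r th0 by rewrite /rh b1 invr1 scale1r.
have lh_cvg j : lh s 0 j @[s --> th0] --> lh th0 0 j.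
  have [_ _ r00 _ Ar0] := lrP th0.
  apply: (perron_left_cvg (ltnW hK) (powmx p th0) (rho p th0) (lh th0) (r th0)
    _ _ (powmx p) (rho p) lh) => //.
  - exact: powmx_ge0.
  - exact: powmx_irreducible.
  - by move=> i k; exact: powmx_cvg.
have rh_cvg j : rh s j 0 @[s --> th0] --> rh th0 j 0.
  have tr_eq (w : 'cV[R]_K) i : w i 0 = w^T 0 i by rewrite mxE.
  have -> : (fun s => rh s j 0) = (fun s => (rh s)^T 0 j).
    by apply/funext => s; rewrite tr_eq.
  rewrite tr_eq.
  apply: (perron_left_cvg (ltnW hK) (powmx p th0)^T (rho p th0) (rh th0)^T (lh th0)^T
    _ _ (fun s => (powmx p s)^T) (rho p) (fun s => (rh s)^T)).
  - by move=> i k; rewrite mxE powmx_ge0.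
  - exact/irreducible_tr/powmx_irreducible.
  - by move=> i; rewrite mxE.
  - by move=> i; rewrite mxE.
  - by rewrite -trmx_mul rhA linearZ.
  - by rewrite -trmx_mul lhA linearZ.
  - by rewrite -trmx_mul mxE rh1.
  - by move=> i k; under eq_fun do rewrite mxE; rewrite mxE; exact: powmx_cvg.
  - exact: rho_cvg.
  - by move=> s i; rewrite mxE.
  - by move=> s; rewrite -trmx_mul rhA linearZ.
  - by move=> s; rewrite -trmx_mul mxE rh1.
(* [g] is invariant under rescaling either eigenvector, so it may be computed from the convergent
   ones. *)
have gE s : g s = (\sum_i \sum_j lh s 0 i * powmx p s i j * ln (p i j) * rh s j 0) /
    (rho p s * \sum_i lh s 0 i * rh s i 0).
  have -> : \sum_i lh s 0 i * rh s i 0 = (a s)^-1 * (b s)^-1 * D s.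
    by rewrite mulr_sumr; apply: eq_bigr => i _; rewrite !mxE mulrACA.
  have -> : \sum_i \sum_j lh s 0 i * powmx p s i j * ln (p i j) * rh s j 0 =
      (a s)^-1 * (b s)^-1 * N s.
    rewrite mulr_sumr; apply: eq_bigr => i _; rewrite mulr_sumr.
    by apply: eq_bigr => j _; rewrite !mxE; ring.
  rewrite /g; field.
  by rewrite !gt_eqF.
rewrite /continuous_at gE (funext gE).
have Dh0 : 0 < rho p th0 * \sum_i lh th0 0 i * rh th0 i 0.
  rewrite mulr_gt0//.
  by have := mulmx_row_col_gt0 (ltnW hK) _ _ (lh0 th0) (rh0 th0); rewrite mxE.
apply: cvgM; last first.
  apply: cvgV; first by rewrite gt_eqF.
  by apply: cvgM => //; apply: cvg_sumr => i; apply: cvgM.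
apply: cvg_sumr => i; apply: cvg_sumr => j; apply: cvgM; last exact: rh_cvg.
apply: cvgM; last exact: cvg_cst.
by apply: cvgM; [exact: lh_cvg|exact: powmx_cvg].
Qed.

End PowMx.

(** * Subgradients of a convex function and their limit at infinity *)

Section Subgradient.
Context {R : realType} {f g : R -> R}.
Hypothesis sub : forall a b, (b - a) * g a <= f b - f a.

(** The subgradient inequalities at [a] and [h + a] trap the difference quotient between [g a] and
    [g (h + a)]. *)
Lemma subgradient_is_derive : continuous g -> forall a : R, is_derive a 1 f (g a).
Proof.
move=> cg a.
have q_cvg : h^-1 *: ((f \o shift a) (h *: 1) - f a) @[h --> 0^'] --> g a.
  have gh : g (h + a) @[h --> 0^'] --> g a.
    apply: (@cvg_comp _ _ _ (fun h => h + a) g _ (nbhs a)); last exact: cg.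
    have : h + a @[h --> 0^'] --> 0 + a.
      by apply: cvgD; [exact: nbhs_dnbhs|exact: cvg_cst].
    by rewrite add0r.
  apply: cvg_zero; apply: norm_cvg0.
  apply: (@squeeze_cvgr _ _ _ _ (fun=> 0) (fun h => `|g (h + a) - g a|)).
  - near=> h; rewrite normr_ge0/= /shift/= !fctE/=.
    have hN0 : h != 0 by near: h; exact: nbhs_dnbhs_neq.
    have -> : h *: (1 : R) = h by rewrite /GRing.scale/= mulr1.
    have -> : h^-1 *: (f (h + a) - f a) = (f (h + a) - f a) / h.
      by rewrite /GRing.scale/= mulrC.
    have h1 := sub a (h + a); have h2 := sub (h + a) a.
    have [h0|h0] : h < 0 \/ h > 0 by apply/orP; rewrite -neq_lt.
      have q1 : (f (h + a) - f a) / h <= g a by rewrite ler_ndivrMr//; lra.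
      have q2 : g (h + a) <= (f (h + a) - f a) / h by rewrite ler_ndivlMr//; lra.
      by rewrite !ler0_norm; lra.
    have q1 : g a <= (f (h + a) - f a) / h by rewrite ler_pdivlMr//; lra.
    have q2 : (f (h + a) - f a) / h <= g (h + a) by rewrite ler_pdivrMr//; lra.
    by rewrite !ger0_norm; lra.
  - exact: cvg_cst.
  - exact: cvg_dist0.
by apply: DeriveDef; [apply/cvg_ex; exists (g a)|exact/cvg_lim].
Unshelve. all: by end_near. Qed.

Lemma subgradient_mono a b : a <= b -> g a <= g b.
Proof.
rewrite le_eqVlt => /predU1P[->//|ab].
have h1 := sub a b; have h2 := sub b a.
have ba0 : 0 < b - a by rewrite subr_gt0.
rewrite -(ler_pM2l ba0); lra.
Qed.

(** As [g] is monotone, its limit is its supremum. The last two clauses bound the slope [f a / a] at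
    large [a]; the constant [c] is there to absorb the [ln K] lost by the greedy word. *)
Lemma subgradient_limit : (exists G, forall a, `|g a| <= G) ->
  exists gam, [/\ g a @[a --> +oo] --> gam, (forall a, g a <= gam),
    (forall e, 0 < e -> exists2 a, 0 < a & f a <= a * (gam + e)) &
    (forall e c, 0 < e -> exists2 a, 0 < a & a * (gam - e) <= f a - c)].
Proof.
move=> [G gG]; pose gam := sup (range g).
have supg : has_sup (range g).
  split; first by exists (g 0), 0.
  by exists G => _ [a _ <-]; exact: le_trans (ler_norm _) (gG a).
have gle a : g a <= gam by apply: sup_upper_bound => //; exists a.
have gge e : 0 < e -> exists2 b, 0 < b & gam - e < g b.
  move=> e0; have [_ [b _ <-] hb] := sup_adherent e0 supg.
  exists (Num.max b 1); first by rewrite lt_max ltr01 orbT.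
  by apply: (lt_le_trans hb); apply: subgradient_mono; rewrite le_max lexx.
exists gam; split => //.
- apply/cvgrPdist_le => e e0; have [b _ hb] := gge e e0.
  near=> a; rewrite ger0_norm ?subr_ge0// lerBlDl -lerBlDr.
  apply: (le_trans (ltW hb)); apply: subgradient_mono.
  by near: a; apply: nbhs_pinfty_ge; exact: num_real.
- move=> e e0; pose a := `|f 0| / e + 1.
  have a0 : 0 < a by rewrite ltr_wpDl// divr_ge0// ltW.
  exists a => //; have h := sub a 0; have ga := gle a.
  have ae : `|f 0| <= a * e by rewrite /a mulrDl divfK ?gt_eqF// lerDl mul1r ltW.
  have := ler_norm (f 0); have : a * g a <= a * gam by rewrite ler_pM2l.
  lra.
- move=> e c e0; have e20 : 0 < e / 2 by rewrite divr_gt0.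
  have [b b0 hb] := gge _ e20.
  (* Past [b] the slope exceeds [gam - e / 2]; this [a] is so far out that the spare
     [(a - b) * (e / 2)] covers all constants. *)
  pose a := b + `|c - f b + b * (gam - e)| / (e / 2) + 1.
  have a0 : b < a by rewrite /a -addrA ltrDl ltr_wpDl// divr_ge0// ltW.
  exists a; first exact: lt_trans a0.
  have h := sub b a.
  have : (a - b) * (gam - e / 2) <= (a - b) * g b.
    by rewrite ler_pM2l ?subr_gt0// ltW.
  have : `|c - f b + b * (gam - e)| <= (a - b) * (e / 2).
    have -> : a - b = `|c - f b + b * (gam - e)| / (e / 2) + 1 by rewrite /a; ring.
    by rewrite mulrDl divfK ?gt_eqF// lerDl mul1r ltW.
  have := ler_norm (c - f b + b * (gam - e)).
  lra.
Unshelve. all: by end_near. Qed.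

End Subgradient.

(** * Box sizes and right eigenvectors *)

Section BoxSize.
Context {R : realType} {K : nat} {p : 'M[R]_K}.
Hypothesis p0 : nonneg_mx p.

Lemma box_size_ge0 i u : 0 <= box_size p i u.
Proof. by elim: u i => [|k u IHu] i //=; rewrite mulr_ge0. Qed.

Lemma powmxE theta i j : 0 < theta -> powmx p theta i j = p i j `^ theta.
Proof.
by move=> t0; rewrite mxE; case: eqP => // ->; rewrite powR0// gt_eqF.
Qed.

Lemma box_size_powR_le theta lam (r : 'cV[R]_K) i u : 0 < theta -> 0 < lam ->
  (forall i, 0 < r i 0) -> powmx p theta *m r = lam *: r ->
  box_size p i u `^ theta * r (last i u) 0 <= lam ^+ size u * r i 0.
Proof.
move=> t0 lam0 r0 Ar; elim: u i => [|k u IHu] i /=.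
  by rewrite powR1 expr0.
rewrite powRM ?box_size_ge0// -mulrA.
apply: (le_trans (ler_wpM2l (powR_ge0 _ _) (IHu k))).
rewrite mulrCA exprSr -[leRHS]mulrA ler_pM2l ?exprn_gt0//.
have /colP/(_ i) := Ar; rewrite !mxE => <-.
rewrite (bigD1 k)//= powmxE// lerDl sumr_ge0// => j _.
by rewrite mulr_ge0 ?powmx_ge0// ltW.
Qed.

Lemma box_size_powR_ge theta lam (r : 'cV[R]_K) i n : 0 < theta -> 0 < lam ->
  (forall i, 0 < r i 0) -> powmx p theta *m r = lam *: r ->
  exists u : n.-tuple 'I_K,
    (lam / K%:R) ^+ n * r i 0 <= box_size p i u `^ theta * r (last i u) 0.
Proof.
move=> t0 lam0 r0 Ar; have K0 : (0 < K)%N by case: K i => // -[].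
elim: n i => [|n IHn] i; first by exists [tuple]; rewrite /= powR1 expr0.
(* The greedy letter: one of the [K] terms with sum [lam * r i 0] is at least their average. *)
have [k hk] : exists k, lam / K%:R * r i 0 <= p i k `^ theta * r k 0.
  apply: contrapT => /forallNP hk.
  have /colP/(_ i) := Ar; rewrite !mxE => e.
  have : \sum_j powmx p theta i j * r j 0 < \sum_(j < K) (lam / K%:R * r i 0).
    apply: ltr_sum; first by apply/hasP; exists (Ordinal K0).
    by move=> j _; rewrite powmxE// ltNge; apply/negP.
  have -> : \sum_(j < K) (lam / K%:R * r i 0) = lam * r i 0.
    rewrite sumr_const card_ord -(mulr_natr (lam / K%:R * r i 0) K); field.
    by rewrite pnatr_eq0 -lt0n.
  by rewrite e ltxx.
have [u hu] := IHn k; exists [tuple of k :: u] => /=.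
rewrite powRM ?box_size_ge0// -mulrA.
apply: le_trans (ler_wpM2l (powR_ge0 _ _) hu).
rewrite exprSr -mulrA [leRHS]mulrCA ler_wpM2l// exprn_ge0// divr_ge0//.
exact: ltW.
Qed.

End BoxSize.

(** * Absence of long deterministic paths *)

Section Deterministic.
Context {R : realType} {K : nat} {p : 'M[R]_K}.
Hypothesis p_stochastic : stochastic p.

Lemma stochastic_le1 i j : p i j <= 1.
Proof.
by case: p_stochastic => p0 p1; rewrite -(p1 i) (bigD1 j)//= lerDl sumr_ge0.
Qed.

Lemma stochastic_eq1 i j : p i j = 1 -> forall k, p i k = (k == j)%:R.
Proof.
move=> pij k; have [->//|kj] := eqVneq k j.
have [p0 p1] := p_stochastic; have := p1 i.
rewrite (bigD1 j)//= pij => /eqP; rewrite -subr_eq0 addrAC subrr add0r.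
by rewrite psumr_eq0// => /allP/(_ k); rewrite mem_index_enum kj => /(_ isT)/eqP.
Qed.

Lemma box_size_le1 i u : box_size p i u <= 1.
Proof.
have [p0 _] := p_stochastic.
by elim: u i => [|k u IHu] i //=; rewrite mulr_ile1 ?box_size_ge0 ?stochastic_le1.
Qed.

(** A total function, with default [i] when no transition is certain, so that [iter] and [orbit]
    apply. *)
Definition sure_successor (i : 'I_K) : 'I_K :=
  if [pick k | p i k == 1] is Some k then k else i.

Lemma sure_successorE i j : p i j = 1 -> sure_successor i = j.
Proof.
move=> pij; rewrite /sure_successor; case: pickP => [k /eqP|/(_ j)].
  rewrite (stochastic_eq1 _ _ pij); case: eqP => // _ /esym/eqP.
  by rewrite oner_eq0.
by rewrite pij eqxx.
Qed.

Lemma box_size_eq1_steps i u : box_size p i u = 1 -> forall m, (m < size u)%N ->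
  p (iter m sure_successor i) (sure_successor (iter m sure_successor i)) = 1.
Proof.
have [p0 _] := p_stochastic.
elim: u i => [|k u IHu] i //= e m.
have pik : p i k = 1.
  apply/eqP; rewrite eq_le stochastic_le1/= -e ler_piMr//; exact: box_size_le1.
have u1 : box_size p k u = 1 by move: e; rewrite pik mul1r.
case: m => [_|m mu] /=; first by rewrite (sure_successorE _ _ pik).
by rewrite -iterS iterSr (sure_successorE _ _ pik) IHu.
Qed.

(** A word of length [K] and size 1 makes the chain deterministic from [i] on. It then returns to
    [i] only at multiples of a least period, which aperiodicity forces to be 1, and an absorbing
    state contradicts irreducibility. *)
Lemma aperiodic_box_size_lt1 : (1 < K)%N -> irreducible_chain p ->
  aperiodic_chain p -> forall i u, size u = K -> box_size p i u < 1.
Proof.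
move=> hK pirr paper i u uK; rewrite lt_neqAle box_size_le1 andbT.
apply/eqP => /box_size_eq1_steps; rewrite uK.
set f := sure_successor => step.
(* The orbit of [i] has at most [K] points, so the first [K] steps already visit all of it. *)
have sure n : p (iter n f i) (f (iter n f i)) = 1.
  have : iter n f i \in orbit f i by rewrite -fconnect_orbit fconnect_iter.
  move=> /trajectP[m mo ->]; apply: step; apply: (leq_trans mo).
  by rewrite -[leqRHS]card_ord max_card.
have pow n m j : (p ^+ n) (iter m f i) j = (j == iter (n + m) f i)%:R.
  elim: n m => [|n IHn] m; first by rewrite expr0 mxE eq_sym add0n.
  rewrite exprS mxE (bigD1 (f (iter m f i)))//= sure mul1r big1 ?addr0.
    by rewrite -iterS IHn addnS.
  by move=> k kN; rewrite (stochastic_eq1 _ _ (sure m)) (negbTE kN) mul0r.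
have exn : exists n, (0 < n)%N && (iter n f i == i).
  have [n] := pirr (f i) i; rewrite (pow n 1%N).
  case: eqP => [e _|_]; last by rewrite ltxx.
  by exists (n + 1)%N; rewrite -e eqxx addn1.
have [n /andP[n0 /eqP ni] nmin] := ex_minnP exn.
have /(paper i n) n1 : forall m, (0 < m)%N -> 0 < (p ^+ m) i i -> (n %| m)%N.
  move=> m _; rewrite (pow m 0%N) addn0; case: eqP => [/esym mi _|_]; last by rewrite ltxx.
  have per k : iter (k * n) f i = i.
    by elim: k => // k IHk; rewrite mulSn iterD IHk ni.
  rewrite /dvdn; apply: contraT; rewrite -lt0n => mn0.
  have := nmin (m %% n)%N; rewrite mn0/= leqNgt ltn_mod n0.
  move: mi; rewrite {1}(divn_eq m n) addnC iterD per => ->.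
  by rewrite eqxx => /(_ isT).
have fi : f i = i by rewrite -[RHS]ni n1.
have fix_ k : iter k f i = i by elim: k => //= k ->.
have [j ji] : exists j : 'I_K, j != i.
  have [->|] := eqVneq i (Ordinal hK); first by exists (Ordinal (ltnW hK)).
  by rewrite eq_sym => ?; exists (Ordinal hK).
by have [m] := pirr i j; rewrite (pow m 0%N) fix_ (negbTE ji) ltxx.
Qed.

End Deterministic.

(** * Exponential rate of the largest box *)

Section GrowthRate.
Context {R : realType} {K : nat} {p : 'M[R]_K}.
Hypothesis hK : (1 < K)%N.
Hypothesis p_stochastic : stochastic p.
Hypothesis p_irr : irreducible_chain p.

(** Take [theta]-th roots in [box_size_powR_le]; the ratio of the bounds [b] and [a] on the entries
    of the eigenvector becomes the constant [D]. Boxes of size 0 are set apart before taking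
    logarithms. *)
Lemma box_size_upper (theta c : R) : 0 < theta -> ln (rho p theta) <= theta * c ->
  exists2 D, 0 < D & forall i u, box_size p i u <= D * expR ((size u)%:R * c).
Proof.
move=> t0 rhoc; have [p0 _] := p_stochastic.
have [l [r lrP]] := perron_family p0 hK p_irr.
have [lam0 _ r0 _ Ar] := lrP theta.
have [a a0 ra] := finite_lower_bound _ _ (fun i => r theta i 0) r0.
have [b b0 rb] := finite_upper_bound _ _ (fun i => r theta i 0).
exists (expR (ln (b / a) / theta)); first exact: expR_gt0.
move=> i u; have [s0|] := ltP 0 (box_size p i u); last first.
  by move/le_trans; apply; rewrite mulr_ge0 ?expR_ge0.
rewrite -expRD -[leLHS]lnK// ler_expR -(ler_pM2l t0) mulrDr mulrCA divff ?mulr1 ?gt_eqF//.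
have : box_size p i u `^ theta <= b / a * rho p theta ^+ size u.
  rewrite mulrAC ler_pdivlMr//.
  apply: (@le_trans _ _ (box_size p i u `^ theta * r theta (last i u) 0)).
    by rewrite ler_wpM2l// powR_ge0.
  apply: (le_trans (box_size_powR_le p0 _ _ _ _ _ t0 lam0 r0 Ar)).
  by rewrite mulrC ler_wpM2r// exprn_ge0// ltW.
rewrite -ler_ln ?posrE ?powR_gt0 ?mulr_gt0 ?exprn_gt0 ?invr_gt0// ln_powR.
rewrite lnM ?posrE ?divr_gt0 ?exprn_gt0// lnXn// -[ln _ *+ _]mulr_natl => h.
by apply: (le_trans h); rewrite lerD2l mulrCA ler_wpM2l.
Qed.

Lemma box_size_lower (theta c : R) : 0 < theta ->
  theta * c <= ln (rho p theta) - ln K%:R ->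
  exists2 D, 0 < D & forall i n, exists u : n.-tuple 'I_K,
    D * expR (n%:R * c) <= box_size p i u.
Proof.
move=> t0 rhoc; have [p0 _] := p_stochastic.
have [l [r lrP]] := perron_family p0 hK p_irr.
have [lam0 _ r0 _ Ar] := lrP theta.
have [a a0 ra] := finite_lower_bound _ _ (fun i => r theta i 0) r0.
have [b b0 rb] := finite_upper_bound _ _ (fun i => r theta i 0).
have K0 : 0 < K%:R :> R by rewrite ltr0n ltnW.
have q0 : 0 < rho p theta / K%:R by rewrite divr_gt0.
exists (expR (ln (a / b) / theta)); first exact: expR_gt0.
move=> i n; have [u hu] := box_size_powR_ge p0 theta _ _ i n t0 lam0 r0 Ar.
exists u; have h : a / b * (rho p theta / K%:R) ^+ n <= box_size p i u `^ theta.
  rewrite mulrAC ler_pdivrMr//.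
  apply: (@le_trans _ _ (box_size p i u `^ theta * r theta (last i u) 0)).
    by apply: le_trans hu; rewrite mulrC ler_wpM2l// exprn_ge0// ltW.
  by rewrite ler_wpM2l// powR_ge0.
have s0 : 0 < box_size p i u.
  rewrite lt_neqAle box_size_ge0// andbT; apply/eqP => e.
  move: h; rewrite -e powR0 ?gt_eqF// leNgt mulr_gt0 ?exprn_gt0 ?divr_gt0//.
rewrite -expRD -[leRHS]lnK// ler_expR -(ler_pM2l t0) mulrDr mulrCA divff ?mulr1 ?gt_eqF//.
move: h; rewrite -ler_ln ?posrE ?powR_gt0 ?mulr_gt0 ?exprn_gt0 ?invr_gt0// ln_powR.
rewrite lnM ?posrE ?divr_gt0 ?exprn_gt0// lnXn// -[ln _ *+ _]mulr_natl => h.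
apply: le_trans h; rewrite lerD2l mulrCA ler_wpM2l//.
by rewrite ln_div ?posrE.
Qed.

Lemma box_growth_rate : aperiodic_chain p -> exists gam : R,
  [/\ gam < 0,
    rho p theta / - derive1 (rho p) theta @[theta --> +oo] --> - gam^-1,
    (forall e, 0 < e -> exists2 D, 0 < D & forall i u,
      box_size p i u <= D * expR ((size u)%:R * (gam + e))) &
    (forall e, 0 < e -> exists2 D, 0 < D & forall i n, exists u : n.-tuple 'I_K,
      D * expR (n%:R * (gam - e)) <= box_size p i u)].
Proof.
move=> p_aper; have [p0 _] := p_stochastic.
have [g [cg sub gG]] := ln_rho_subgradient p0 hK p_irr.
have [gam [g_cvg g_le upper lower]] := subgradient_limit sub gG.
have [l [r lrP]] := perron_family p0 hK p_irr.
have rho0 theta : 0 < rho p theta by have [] := lrP theta.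
have K0 : 0 < K%:R :> R by rewrite ltr0n ltnW.
(* All words of length [K] have size at most some [q < 1]. The greedy word from the state with the
   largest entry of [r] gives [(rho / K)^K <= q^theta], hence [K * (gam - e) <= ln q]; [e] is chosen
   so that [K * e] is half of [- ln q]. *)
have gam0 : gam < 0.
  have [q q0 [q1 hq]] : exists2 q, 0 < q & q < 1 /\ forall i (u : K.-tuple 'I_K), box_size p i u <= q.
    have [|e e0 he] := finite_lower_bound _ _
      (fun iu : 'I_K * K.-tuple 'I_K => 1 - box_size p iu.1 iu.2).
      move=> [i u]; rewrite subr_gt0.
      by apply: (aperiodic_box_size_lt1 p_stochastic); rewrite ?size_tuple.
    (* The minimum with [1 / 2] keeps [q] positive, so that [ln q] is meaningful. *)
    exists (1 - Num.min e (1 / 2)).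
      by rewrite subr_gt0 gt_min; apply/orP; right; lra.
    split.
      by rewrite ltrBlDr ltrDl lt_min e0/=; lra.
    move=> i u; have := he (i, u) => /= h.
    by rewrite lerBrDr -lerBrDl ge_min h.
  have lnq0 : ln q < 0 by rewrite ln_lt0// q0 q1.
  pose e := - ln q / (2 * K%:R).
  have e0 : 0 < e by rewrite divr_gt0 ?mulr_gt0// oppr_gt0.
  have [theta t0 h] := lower e (ln K%:R) e0.
  have [lam0 _ r0 _ Ar] := lrP theta.
  case: (@arg_maxP _ _ _ (Ordinal (ltnW hK)) predT (fun i => r theta i 0)) => // i _ imax.
  have [u hu] := box_size_powR_ge p0 theta _ _ i K t0 lam0 r0 Ar.
  have : (rho p theta / K%:R) ^+ K <= q `^ theta.
    rewrite -(ler_pM2r (r0 i)); apply: (le_trans hu).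
    apply: ler_pM; [exact: powR_ge0|exact: ltW| |exact: imax].
    apply: (ge0_ler_powR (ltW t0)); rewrite ?nnegrE ?box_size_ge0 ?hq//.
    exact: ltW.
  rewrite -ler_ln ?posrE ?powR_gt0 ?exprn_gt0 ?divr_gt0// ln_powR lnXn ?divr_gt0//.
  rewrite ln_div ?posrE// -[(_ - _) *+ _]mulr_natl => h2.
  have h3 : K%:R * (theta * (gam - e)) <= theta * ln q.
    by apply: le_trans h2; rewrite ler_pM2l.
  have h4 : K%:R * (gam - e) <= ln q by rewrite -(ler_pM2l t0) mulrCA.
  have h5 : K%:R * e = - ln q / 2 by rewrite /e; field; rewrite gt_eqF.
  rewrite -(pmulr_rlt0 _ K0); lra.
exists gam; split => //.
- have drv theta : derive1 (rho p) theta = rho p theta * g theta.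
    have df := subgradient_is_derive sub cg theta.
    have rhoE : rho p = expR \o (fun s => ln (rho p s)).
      by apply/funext => s /=; rewrite lnK// posrE.
    have drho := @is_derive1_comp R expR (fun s => ln (rho p s)) theta _ _
      (is_derive_expR (ln (rho p theta))) df.
    by rewrite derive1E {1}rhoE derive_val lnK// posrE.
  have -> : (fun theta => rho p theta / - derive1 (rho p) theta) = fun theta => - (g theta)^-1.
    apply/funext => theta; rewrite drv -mulrN invfM mulrA divff ?mul1r ?invrN//.
    by rewrite gt_eqF.
  by apply: cvgN; apply: cvgV => //; rewrite lt_eqF.
- by move=> e /upper[theta t0 h]; exact: box_size_upper h.
- by move=> e e0; have [theta t0 h] := lower e (ln K%:R) e0; exact: box_size_lower h.
Qed.

End GrowthRate.

(** * Occupancy of a box *)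

(** Gathers finitely many bad events into one measurable exceptional event, the form in which
    Borel-Cantelli is applied later. *)
Lemma union_bound (d : measure_display) (T : measurableType d) (R : realType)
    (P : probability T R) (I : finType) (E : I -> set T) (c : R) :
  (forall i, measurable (E i)) -> (forall i, (P (E i) <= c%:E)%E) ->
  exists B, [/\ measurable B, (P B <= (#|I|%:R * c)%:E)%E &
    forall i, E i `<=` B].
Proof.
move=> mE Ec; exists (\big[setU/set0]_i E i); split.
- exact: bigsetU_measurable.
- rewrite mulr_natl -sumr_const -sumEFin.
  suff [] : measurable (\big[setU/set0]_i E i) /\
     (P (\big[setU/set0]_i E i) <= \sum_(i : I) c%:E)%E by [].
  elim/big_ind2: _ => // [|A a B b [mA PA] [mB PB]]; first by rewrite measure0.
  split; first exact: measurableU.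
  by apply: (le_trans (measureU2 P mA mB)); exact: leeD.
- by move=> i t Eit; rewrite (bigD1 i)//=; left.
Qed.

Section Balls.
Context {d : measure_display} {T : measurableType d} {R : realType}.
Context {P : probability T R} {K : nat} {p : 'M[R]_K} {root : 'I_K}.
Context {fall : nat -> nat -> T -> 'I_K}.
Hypothesis p0 : nonneg_mx p.
Hypothesis balls : ball_process P p root fall.

Definition ball_in_box (b : nat) (u : seq 'I_K) : set T :=
  [set t | box_of fall b (size u) t = u].

Lemma ball_in_box_rcons b u k : ball_in_box b (rcons u k) =
  ball_in_box b u `&` [set t | fall b (size u) t = k].
Proof.
rewrite /ball_in_box /box_of size_rcons; apply/seteqP; split => t /=.
  by rewrite mkseqS => /rcons_inj[].
by rewrite mkseqS => -[-> ->].
Qed.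

Lemma ball_in_box_trajectory b u : trajectory_events fall b (ball_in_box b u).
Proof.
pose G := [set E : set T | exists n k, E = [set t | fall b n t = k]].
suff : measurable (ball_in_box b u : set (g_sigma_algebraType G)) by [].
elim/last_ind: u => [|u k IHu].
  rewrite (_ : ball_in_box b [::] = setT); first exact: measurableT.
  by apply/seteqP.
rewrite ball_in_box_rcons; apply: measurableI => //.
by apply: sub_sigma_algebra; exists (size u), k.
Qed.

Lemma trajectory_eventsC b E : trajectory_events fall b E ->
  trajectory_events fall b (~` E).
Proof.
pose G := [set E : set T | exists n k, E = [set t | fall b n t = k]].
move=> tE; suff : measurable (~` E : set (g_sigma_algebraType G)) by [].
exact: measurableC.
Qed.

Lemma trajectory_events_measurable b E : trajectory_events fall b E -> measurable E.
Proof.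
have [mfall _ _] := balls.
apply: smallest_sub; first exact: sigma_algebra_measurable.
by move=> _ [n [k ->]].
Qed.

Lemma ball_in_box_measurable b u : measurable (ball_in_box b u).
Proof. exact: trajectory_events_measurable (ball_in_box_trajectory b u). Qed.

Lemma prob_ball_in_box b u : P (ball_in_box b u) = (box_size p root u)%:E.
Proof.
elim/last_ind: u => [|u k IHu].
  rewrite (_ : ball_in_box b [::] = setT); first exact: probability_setT.
  by apply/seteqP.
have [_ /(_ b u k) Pk _] := balls.
rewrite /ball_in_box size_rcons Pk IHu -EFinM box_size_rcons.
(* In a box of size 0 the quotient is a default value, but it is multiplied by probability 0. *)
have [->|N0] := eqVneq (box_size p root u) 0; first by rewrite !mul0r.
by rewrite mulrC divfK.
Qed.

Lemma prob_all_balls (J : seq nat) u : uniq J ->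
  P (\bigcap_(b in [set` J]) ball_in_box b u) = (box_size p root u ^+ size J)%:E.
Proof.
move=> uJ; have [_ _ indep] := balls.
rewrite (indep J (fun b => ball_in_box b u))//; last first.
  by move=> b _; exact: ball_in_box_trajectory.
under eq_bigr do rewrite prob_ball_in_box.
by rewrite prodEFin big_const_seq count_predT iter_mulr_1.
Qed.

Lemma prob_no_ball (J : seq nat) u : uniq J ->
  P (\bigcap_(b in [set` J]) ~` ball_in_box b u) =
  ((1 - box_size p root u) ^+ size J)%:E.
Proof.
move=> uJ; have [_ _ indep] := balls.
rewrite (indep J (fun b => ~` ball_in_box b u))//; last first.
  by move=> b _; apply: trajectory_eventsC; exact: ball_in_box_trajectory.
under eq_bigr do
  rewrite (probability_setC P (ball_in_box_measurable _ u)) prob_ball_in_box -EFinB.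
by rewrite prodEFin big_const_seq count_predT iter_mulr_1.
Qed.

Lemma box_size_prob_le1 u : box_size p root u <= 1.
Proof.
by rewrite -lee_fin -(prob_ball_in_box 0%N); apply: probability_le1; exact: ball_in_box_measurable.
Qed.

Lemma seq_bigcap_measurable (J : seq nat) (E : nat -> set T) :
  (forall b, measurable (E b)) -> measurable (\bigcap_(b in [set` J]) E b).
Proof. by move=> mE; apply: fin_bigcap_measurable => // b _; exact: mE. Qed.

(* Union bound over the boxes and over the sets of [j] balls. *)
Lemma prob_large_occupancy (m n j : nat) (s : R) :
  (forall u : n.-tuple 'I_K, box_size p root u <= s) ->
  exists B, [/\ measurable B, (P B <= ((K ^ n * 'C(m, j))%:R * s ^+ j)%:E)%E &
    forall t, ~ B t -> forall u : n.-tuple 'I_K, (occupancy fall m n u t < j)%N].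
Proof.
move=> us.
pose I := (n.-tuple 'I_K * {S : {set 'I_m} | #|S| == j})%type.
pose E (i : I) := \bigcap_(b in [set` map val (enum (val i.2))]) ball_in_box b i.1.
have [||B [mB PB EB]] := @union_bound _ _ _ P I E (s ^+ j).
- by move=> i; apply: seq_bigcap_measurable => b; exact: ball_in_box_measurable.
- move=> [u [S Sj]]; rewrite prob_all_balls/=; last first.
    by rewrite map_inj_uniq ?enum_uniq//; exact: val_inj.
  rewrite size_map -cardE (eqP Sj) lee_fin lerXn2r ?nnegrE ?box_size_ge0//.
  exact: le_trans (box_size_ge0 p0 _ _) (us u).
have cardI : #|{: I}| = (K ^ n * 'C(m, j))%N.
  rewrite card_prod card_tuple card_ord card_sig; congr (_ * _)%N.
  by rewrite -[in RHS](card_ord m) -card_draws cardsE.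
exists B; split => //; first by rewrite -cardI.
move=> t Bt u; rewrite ltnNge; apply/negP => occ; apply: Bt.
(* If [u] held at least [j] balls, some [j]-subset [S] of them would witness the bad event indexed
   by [(u, S)]. *)
pose A := finset (fun b : 'I_m => box_of fall b n t == u).
have : (0 < 'C(#|A|, j))%N by rewrite bin_gt0 cardsE.
rewrite -cards_draws card_gt0 => /set0Pn[S]; rewrite inE => /andP[SA Sj].
apply: (EB (u, exist _ S Sj)) => b /= /mapP[c]; rewrite mem_enum => cS ->.
by have := fintype.subsetP SA c cS; rewrite inE => /eqP; rewrite /ball_in_box/= size_tuple.
Qed.

(* If each of [j] disjoint blocks of [m %/ j] balls has a ball in [u], then [u]
   holds at least [j] balls. *)
Lemma prob_small_occupancy (m n j : nat) (u : n.-tuple 'I_K) :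
  exists B, [/\ measurable B,
    (P B <= (j%:R * (1 - box_size p root u) ^+ (m %/ j))%:E)%E &
    forall t, ~ B t -> (j <= occupancy fall m n u t)%N].
Proof.
pose L := (m %/ j)%N.
pose E (k : 'I_j) := \bigcap_(b in [set` iota (k * L) L]) ~` ball_in_box b u.
have [||B [mB PB EB]] := @union_bound _ _ _ P 'I_j E ((1 - box_size p root u) ^+ L).
- move=> i; apply: seq_bigcap_measurable => b; apply: measurableC.
  exact: ball_in_box_measurable.
- by move=> k; rewrite prob_no_ball ?iota_uniq// size_iota.
exists B; split => //; first by move: PB; rewrite card_ord.
move=> t Bt.
have hit (k : 'I_j) : {b : nat | (k * L <= b < k * L + L)%N & ball_in_box b u t}.
  apply: cid2; apply: contrapT => nb; apply: Bt; apply: (EB k) => b /=.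
  by rewrite mem_iota => bk; apply: contra_not nb => bu; exists b.
have jL : (j * L <= m)%N by rewrite mulnC; exact: leq_trunc_div.
have hm (k : 'I_j) : (s2val (hit k) < m)%N.
  case: (hit k) => b /= /andP[_ bk] _; apply: (leq_trans bk); apply: leq_trans jL.
  by rewrite addnC -mulSn leq_mul2r ltn_ord orbT.
pose h k := Ordinal (hm k).
(* The block of a ball is recovered as its index divided by [L]; [L] is positive since the block
   contains a ball. *)
have hinj : injective h.
  move=> k1 k2 /(congr1 val) /= e.
  have kE (k : 'I_j) : (s2val (hit k) %/ L)%N = k.
    case: (hit k) => b /= bk _; have L0 : (0 < L)%N.
      by rewrite lt0n; apply/eqP => L0; move: bk; rewrite L0 !muln0.
    have /andP[b1 b2] := bk.
    by rewrite -(subnKC b1) divnMDl// divn_small ?addn0// ltn_subLR.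
  by apply: val_inj => /=; rewrite -kE -(kE k2) e.
rewrite -[leqLHS](card_ord j) -(card_codom hinj) /occupancy.
apply: subset_leq_card; apply/fintype.subsetP => _ /codomP[k ->]; rewrite inE /h/=.
by case: (hit k) => b /= _; rewrite /ball_in_box/= size_tuple => ->.
Qed.

End Balls.

(** * Summable bounds *)

Section Estimates.
Context {R : realType}.
Implicit Types (x a b c q s w D alpha delta : R) (m n j : nat).

Lemma affine_le_exp a b c delta : 0 < c -> 0 < delta ->
  exists X, forall x, X <= x -> a * x + b <= c * expR (delta * x).
Proof.
move=> c0 d0; pose S := `|a| + `|b|; pose E := c * delta ^+ 2 / 2.
have E0 : 0 < E by rewrite divr_gt0// mulr_gt0// exprn_gt0.
exists (1 + S / E) => x Xx.
have S0 : 0 <= S by rewrite addr_ge0.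
have x1 : 1 <= x by apply: le_trans Xx; rewrite lerDl divr_ge0// ltW.
have SE : S <= x * E.
  rewrite -ler_pdivrMr//; apply: le_trans Xx; lra.
have x0 : 0 <= x by lra.
have h : 1 + (delta * x) ^+ 2 / 2 <= expR (delta * x).
  by apply: (expR_ge1Dxn 1%N); rewrite mulr_ge0// ltW.
have h2 : c * (1 + (delta * x) ^+ 2 / 2) <= c * expR (delta * x) by rewrite ler_pM2l.
have h3 : a * x + b <= S * x.
  have ha : a * x <= `|a| * x by rewrite ler_wpM2r// ler_norm.
  have hb : b <= `|b| * x by apply: (le_trans (ler_norm b)); rewrite ler_peMr.
  by rewrite /S mulrDl lerD.
have h4 : S * x <= x * E * x by rewrite ler_wpM2r.
apply: (le_trans h3); apply: (le_trans h4); apply: le_trans h2.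
have -> : x * E * x = c * ((delta * x) ^+ 2 / 2) by rewrite /E; field.
by rewrite ler_pM2l// lerDr.
Qed.

Lemma near_ln_ge x : \forall m \near \oo, x <= ln (m%:R : R).
Proof.
near=> m.
have mx : expR x <= m%:R.
  apply: (ltW (lt_le_trans (truncnS_gt _) _)); rewrite ler_nat.
  by near: m; exact: nbhs_infty_ge.
rewrite -[leLHS]expRK ler_ln// posrE ?expR_gt0//.
exact: lt_le_trans (expR_gt0 _) mx.
Unshelve. all: by end_near. Qed.

Lemma ffact_le_expn m j : (m ^_ j <= m ^ j)%N.
Proof.
elim: j => // j IHj; rewrite ffactnSr expnSr leq_mul//; exact: leq_subr.
Qed.

(** Combines ['C(m, j) <= m^j / j!] with [j^j / j! <= e^j], the latter by keeping a single term of
    the exponential series at [j]. *)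
Lemma bin_expr_le m j s q : (0 < j)%N -> 0 <= s -> m%:R * s <= q * j%:R ->
  'C(m, j)%:R * s ^+ j <= (q * expR 1) ^+ j.
Proof.
move=> j0 s0 msq.
have jf0 : 0 < (j`!)%:R :> R by rewrite ltr0n fact_gt0.
have q0 : 0 <= q.
  rewrite -(pmulr_lge0 _ (_ : 0 < j%:R)) ?ltr0n//.
  by apply: le_trans msq; rewrite mulr_ge0.
have jj : j%:R ^+ j <= (j`!)%:R * expR 1 ^+ j :> R.
  rewrite mulrC -ler_pdivrMr// -expRM_natl mulr1.
  have := @expR_ge1Dxn R j%:R j.-1 (ler0n _ _); rewrite prednK//.
  by apply: le_trans; rewrite lerDr.
rewrite -(ler_pM2r jf0) mulrAC -natrM bin_ffact exprMn.
apply: (@le_trans _ _ ((m%:R * s) ^+ j)).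
  by rewrite exprMn ler_wpM2r ?exprn_ge0// -natrX ler_nat ffact_le_expn.
apply: (@le_trans _ _ ((q * j%:R) ^+ j)).
  by rewrite lerXn2r// nnegrE mulr_ge0.
by rewrite exprMn -mulrA ler_wpM2l ?exprn_ge0// [leRHS]mulrC.
Qed.

(** With [s] the bound on box sizes, [m * s] is at most [e^-2 * j], so the binomial bound is at most
    [e^-j]. As [j] is of order [m^alpha], this beats [K^n], which is only polynomial in [m]. *)
Lemma large_occupancy_estimate (K : nat) a w alpha delta D :
  (0 < K)%N -> 0 <= a -> 0 <= w -> 0 < alpha -> 0 < delta -> 0 < D ->
  a * w = 1 - alpha + delta ->
  exists X, forall m n j, X <= ln (m%:R : R) ->
    n = (Num.truncn (a * ln (m%:R : R))).+1 ->
    j = Num.truncn ((m%:R : R) `^ alpha) ->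
    (K ^ n * 'C(m, j))%:R * (D * expR (- (n%:R * w))) ^+ j <=
      expR (- (2 * ln (m%:R : R))).
Proof.
move=> K0 a0 w0 al0 d0 D0 aw.
have [X1 hX1] := affine_le_exp (a * ln K%:R + 2) (ln K%:R + 1) 1 alpha ltr01 al0.
(* [1 / alpha] ensures [2 <= J], hence [J / 2 <= j] after truncation; the last threshold absorbs [D]
   and gives the factor [e^-2]. *)
exists (Num.max X1 (Num.max 1 (Num.max (1 / alpha) ((ln (2 * D) + 2) / delta)))).
move=> m n j; rewrite !ge_max => /and4P[xX1 x1 xal xd] nE jE.
set x := ln m%:R in xX1 x1 xal xd nE *.
have m0 : 0 < m%:R :> R.
  by rewrite ltNge; apply/negP => mle0; move: x1; rewrite /x ln0// ler10.
have mE : m%:R = expR x by rewrite lnK.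
have JE : m%:R `^ alpha = expR (alpha * x) by rewrite /powR gt_eqF.
pose J := expR (alpha * x).
have /andP[jJ Jj] : j%:R <= J < j.+1%:R.
  by rewrite jE JE; apply: truncn_itv; exact: expR_ge0.
have J2 : 2 <= J.
  have : 1 <= alpha * x by rewrite mulrC -ler_pdivrMr.
  have := expR_ge1Dx (alpha * x); rewrite -/J; lra.
rewrite -natr1 in Jj.
have j0 : (0 < j)%N by rewrite -(ltr0n R); lra.
have K1 : 0 <= ln K%:R :> R by rewrite ln_ge0// ler1n.
have nx : a * x <= n%:R by rewrite nE; exact/ltW/truncnS_gt.
have nx1 : n%:R <= a * x + 1.
  rewrite nE -natr1 lerD2r.
  by have /andP[] := truncn_itv (mulr_ge0 a0 (le_trans ler01 x1)).
pose s := D * expR (- (n%:R * w)).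
have s0 : 0 <= s by rewrite mulr_ge0 ?expR_ge0// ltW.
have sle : s <= D * expR (- ((1 - alpha + delta) * x)).
  rewrite ler_pM2l// ler_expR lerN2 -aw mulrAC ler_wpM2r//.
have msj : m%:R * s <= expR (- 2) * j%:R.
  apply: (@le_trans _ _ (m%:R * (D * expR (- ((1 - alpha + delta) * x))))).
    by rewrite ler_wpM2l// ltW.
  apply: (@le_trans _ _ (expR (- 2) * (J / 2))); last first.
    by rewrite ler_wpM2l ?expR_ge0//; lra.
  have -> : m%:R * (D * expR (- ((1 - alpha + delta) * x))) =
      (2 * D) * expR (- (delta * x)) * (J / 2).
    rewrite mE /J.
    have -> : - ((1 - alpha + delta) * x) = - x + - (delta * x) + alpha * x by ring.
    by rewrite !expRD expRN; field; rewrite gt_eqF// expR_gt0.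
  rewrite ler_wpM2r//; first by lra.
  rewrite -[2 * D]lnK ?posrE ?mulr_gt0// -expRD ler_expR.
  by move: xd; rewrite ler_pdivrMr// mulrC; lra.
have Cs : 'C(m, j)%:R * s ^+ j <= expR (- j%:R).
  apply: (le_trans (bin_expr_le _ _ _ _ j0 s0 msj)).
  rewrite -expRD -expRM_natl ler_expR; lra.
rewrite natrM -mulrA natrX.
have Kn : K%:R ^+ n <= expR ((a * x + 1) * ln K%:R) :> R.
  rewrite -[K%:R in leLHS]lnK ?posrE ?ltr0n// -expRM_natl ler_expR.
  by rewrite ler_wpM2r.
apply: (@le_trans _ _ (expR ((a * x + 1) * ln K%:R) * expR (- j%:R))).
  by apply: ler_pM; rewrite ?exprn_ge0// mulr_ge0// exprn_ge0.
rewrite -expRD ler_expR.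
have := hX1 x xX1; rewrite -/J; lra.
Qed.

(** A block has [L] of order [m^(1 - alpha)] balls, so [b * L] is at least a constant times
    [m^delta] and [(1 - b)^L <= e^-(b * L)] beats every power of [m]. *)
Lemma small_occupancy_estimate a w alpha delta D :
  0 <= a -> 0 <= w -> 0 < alpha -> alpha < 1 -> 0 < delta -> 0 < D ->
  a * w = 1 - alpha - delta ->
  exists X, forall m n j b, X <= ln (m%:R : R) ->
    n = Num.truncn (a * ln (m%:R : R)) ->
    j = (Num.truncn ((m%:R : R) `^ alpha)).+1 ->
    D * expR (- (n%:R * w)) <= b -> b <= 1 ->
    j%:R * (1 - b) ^+ (m %/ j) <= expR (- (2 * ln (m%:R : R))).
Proof.
move=> a0 w0 al0 al1 d0 D0 aw.
have D40 : 0 < D / 4 by rewrite divr_gt0.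
have [X1 hX1] := affine_le_exp (alpha + 2) 1 (D / 4) delta D40 d0.
(* The last threshold gives [4 <= Q], so that rounding [j] up and [m %/ j] down still leaves
   [Q / 4 <= L]. *)
exists (Num.max X1 (Num.max 1 (3 / (1 - alpha)))).
move=> m n j b; rewrite !ge_max => /and3P[xX1 x1 xal] nE jE hb b1.
set x := ln m%:R in xX1 x1 xal nE *.
have m0 : 0 < m%:R :> R.
  by rewrite ltNge; apply/negP => mle0; move: x1; rewrite /x ln0// ler10.
have mE : m%:R = expR x by rewrite lnK.
have JE : m%:R `^ alpha = expR (alpha * x) by rewrite /powR gt_eqF.
pose J := expR (alpha * x).
have J1 : 1 <= J by rewrite -expR0 ler_expR mulr_ge0//; lra.
have jJ : j%:R <= 2 * J.
  rewrite jE JE -natr1; have /andP[] := truncn_itv (expR_ge0 (alpha * x)).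
  rewrite -/J; lra.
pose Q := expR ((1 - alpha) * x).
have Q4 : 4 <= Q.
  have : 3 <= (1 - alpha) * x by rewrite mulrC -ler_pdivrMr// subr_gt0.
  have := expR_ge1Dx ((1 - alpha) * x); rewrite -/Q; lra.
have mQJ : m%:R = Q * J by rewrite mE -expRD; congr expR; ring.
pose L := (m %/ j)%N.
have LQ : Q / 4 <= L%:R.
  have : m%:R < L.+1%:R * j%:R :> R by rewrite -natrM ltr_nat ltn_ceil// jE.
  rewrite -natr1 mQJ => h.
  have h2 : Q * J < (L%:R + 1) * (2 * J).
    by apply: (lt_le_trans h); rewrite ler_wpM2l// addr_ge0.
  have : Q < (L%:R + 1) * 2.
    by rewrite -(ltr_pM2r (lt_le_trans ltr01 J1)) -mulrA.
  lra.
have nx : n%:R <= a * x.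
  by rewrite nE; have /andP[] := truncn_itv (mulr_ge0 a0 (le_trans ler01 x1)).
have bge : D * expR (- ((1 - alpha - delta) * x)) <= b.
  by apply: le_trans hb; rewrite ler_pM2l// ler_expR lerN2 -aw mulrAC ler_wpM2r.
have bL : D / 4 * expR (delta * x) <= b * L%:R.
  apply: (@le_trans _ _ (D * expR (- ((1 - alpha - delta) * x)) * (Q / 4))).
    rewrite le_eqVlt; apply/orP; left; apply/eqP.
    have -> : - ((1 - alpha - delta) * x) = delta * x - (1 - alpha) * x by ring.
    by rewrite expRD expRN -/Q; field; rewrite gt_eqF// expR_gt0.
  apply: ler_pM => //; first by rewrite mulr_ge0 ?expR_ge0// ltW.
  by lra.
have pow : (1 - b) ^+ L <= expR (- (b * L%:R)).
  rewrite -mulNr expRM_natr lerXn2r ?nnegrE ?expR_ge0 ?subr_ge0//.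
  exact: expR_ge1Dx.
apply: (@le_trans _ _ (expR (1 + alpha * x) * expR (- (b * L%:R)))).
  apply: ler_pM => //; first by rewrite exprn_ge0// subr_ge0.
  apply: (le_trans jJ); rewrite expRD ler_wpM2r ?expR_ge0//.
  by have := expR_ge1Dx (1 : R); lra.
rewrite -expRD ler_expR; have := hX1 x xX1; lra.
Qed.

End Estimates.

Lemma borel_cantelli_ae (d : measure_display) (T : measurableType d) (R : realType)
    (P : probability T R) (E : nat -> set T) :
  (forall m, measurable (E m)) ->
  (\forall m \near \oo, (P (E m) <= (expR (- (2 * ln (m%:R : R))))%:E)%E) ->
  {ae P, forall t, \forall m \near \oo, ~ E m t}.
Proof.
move=> mE [N _ hN].
(* The cut at [N.+1] drops the indices without a bound and always drops [m = 0], where [ln 0] is a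
   default value. *)
pose F m := if (m < N.+1)%N then set0 else E m.
have mF m : measurable (F m) by rewrite /F; case: ifP.
(* The series of [n^-2] is compared with a telescoping one: [(n + 1) * (n + 2) <= 6 * n^2] for
   [n >= 1], with equality at 1. *)
have PF n : (\sum_(0 <= k < n) P (F k) <= (6 * (1 - n.+1%:R^-1))%:E)%E.
  elim: n => [|n IHn]; first by rewrite big_geq// invr1 subrr mulr0.
  rewrite big_nat_recr//=.
  have step : (P (F n) <= (6 * (n.+1%:R^-1 - n.+2%:R^-1))%:E)%E.
    have n10 : 0 < n.+1%:R :> R by rewrite ltr0n.
    have n20 : 0 < n.+2%:R :> R by rewrite ltr0n.
    have dE : n.+1%:R^-1 - n.+2%:R^-1 = (n.+1%:R * n.+2%:R)^-1 :> R.
      rewrite -[n.+2%:R]natr1; move: (n.+1%:R : R) n10 => y y0; field.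
      by apply/andP; split; rewrite gt_eqF//; lra.
    rewrite dE /F; case: ltnP => [_|Nn].
      by rewrite measure0 lee_fin mulr_ge0// invr_ge0 mulr_ge0// ltW.
    have n1 : 1 <= n%:R :> R by rewrite ler1n; exact: leq_trans Nn.
    have n0 : 0 < n%:R :> R by exact: lt_le_trans n1.
    apply: (le_trans (hN n (ltnW Nn))); rewrite lee_fin expRN expRM_natl lnK//.
    rewrite ler_pdivlMr ?mulr_gt0// mulrC ler_pdivrMr ?exprn_gt0//.
    rewrite -[n.+2%:R]natr1 -[n.+1%:R]natr1; nra.
  apply: (le_trans (leeD IHn step)); rewrite -EFinD lee_fin.
  by rewrite le_eqVlt; apply/orP; left; apply/eqP; ring.
have sumF : (\sum_(n <oo) P (F n) < +oo)%E.
  apply: (@le_lt_trans _ _ 6%:E); last exact: ltry.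
  apply: lime_le; first by apply: is_cvg_nneseries => n _ _; exact: measure_ge0.
  apply: nearW => n; apply: (le_trans (PF n)); rewrite lee_fin.
  by rewrite -[leRHS]mulr1 ler_wpM2l// gerBl invr_ge0.
exists (lim_sup_set F); split.
- by apply: bigcapT_measurable => n; apply: bigcup_measurable.
- exact: lim_sup_set_cvg0.
- move=> t /= nt n _; apply: contrapT => nF; apply: nt.
  exists (maxn n N.+1) => // m /=; rewrite geq_max => /andP[nm Nm] Et.
  by apply: nF; exists m => //; rewrite /F ltnNge Nm.
Qed.

(** * Height and occupancy *)

Section Height.
Context {R : realType} {T : Type} {K : nat} {fall : nat -> nat -> T -> 'I_K}.

Lemma occupancy_take m n n' (u : seq 'I_K) t : (n' <= n)%N ->
  (occupancy fall m n u t <= occupancy fall m n' (take n' u) t)%N.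
Proof.
move=> nn; apply: subset_leq_card; apply/fintype.subsetP => b; rewrite !inE => /eqP <-.
by rewrite /box_of /mkseq -map_take take_iota (minn_idPl nn).
Qed.

Lemma H_le m n (J : R) t :
  (forall u : n.-tuple 'I_K, (occupancy fall m n u t)%:R < J) ->
  (H fall m J t <= (n%:R)%:E)%E.
Proof. by move=> h; apply: ereal_inf_lbound; exists n. Qed.

(** Balls in [u] were earlier in every prefix of [u], so one crowded box at generation [n] rules out
    all earlier generations. *)
Lemma H_ge m n (J : R) (u : n.-tuple 'I_K) t :
  J <= (occupancy fall m n u t)%:R -> ((n%:R)%:E <= H fall m J t)%E.
Proof.
move=> Ju; apply: le_ereal_inf_tmp => _ [n' hn' <-]; rewrite lee_fin ler_nat.
rewrite leqNgt; apply/negP => n'n.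
have size_take : size (take n' u) == n' by rewrite size_takel ?size_tuple// ltnW.
have := hn' (Tuple size_take); rewrite ltNge => /negP; apply.
by apply: (le_trans Ju); rewrite ler_nat/= occupancy_take// ltnW.
Qed.

End Height.

(** * Almost sure bounds on the height *)

Section Sandwich.
Context {R : realType} {K : nat} {p : 'M[R]_K} {root : 'I_K}.
Context {d : measure_display} {T : measurableType d} {P : probability T R}.
Context {fall : nat -> nat -> T -> 'I_K}.
Hypothesis p0 : nonneg_mx p.
Hypothesis balls : ball_process P p root fall.
Context {alpha kappa : R}.
Hypothesis alpha_gt0 : 0 < alpha.
Hypothesis alpha_lt1 : alpha < 1.
Hypothesis kappa_gt0 : 0 < kappa.

Lemma H_upper_ae (eta : R) :
  (forall e, 0 < e -> exists2 D, 0 < D & forall u,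
      box_size p root u <= D * expR ((size u)%:R * (- kappa + e))) ->
  0 < eta ->
  {ae P, forall t, \forall m \near \oo,
    (H fall m ((m%:R : R) `^ alpha) t <=
      (((1 - alpha) / kappa + eta) * ln (m%:R : R) + 1)%:E)%E}.
Proof.
move=> upper eta0; pose a := (1 - alpha) / kappa + eta.
have a0 : 0 < a by rewrite addr_gt0// divr_gt0// subr_gt0.
(* Half of the gain [eta * kappa] in the exponent is spent on the error [e]; the other half is the
   margin [delta] of the estimate. *)
pose e := eta * kappa / (2 * a).
have e0 : 0 < e by rewrite !(divr_gt0, mulr_gt0).
have [D D0 hD] := upper e e0.
have w0 : 0 <= kappa - e.
  rewrite subr_ge0 /e ler_pdivrMr ?mulr_gt0// mulrC ler_pM2l//.
  have : 0 < (1 - alpha) / kappa by rewrite divr_gt0// subr_gt0.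
  by rewrite /a; lra.
have aw : a * (kappa - e) = 1 - alpha + eta * kappa / 2.
  have -> : a * (kappa - e) = a * kappa - eta * kappa / 2.
    by rewrite /e; field; rewrite gt_eqF.
  by rewrite /a; field; rewrite gt_eqF.
have K0 : (0 < K)%N by case: K root => // -[].
have dl0 : 0 < eta * kappa / 2 by rewrite !(divr_gt0, mulr_gt0).
have [X hX] := large_occupancy_estimate _ _ _ _ _ _ K0 (ltW a0) w0 alpha_gt0 dl0 D0 aw.
pose n m := (Num.truncn (a * ln (m%:R : R))).+1.
(* Rounding down: fewer than [j m] balls is strictly fewer than [m^alpha]. *)
pose j m := Num.truncn ((m%:R : R) `^ alpha).
have /choice[B hB] : forall m, exists B, [/\ measurable B,
    (P B <= ((K ^ n m * 'C(m, j m))%:R *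
      (D * expR (- ((n m)%:R * (kappa - e)))) ^+ j m)%:E)%E &
    forall t, ~ B t -> forall u : (n m).-tuple 'I_K, (occupancy fall m (n m) u t < j m)%N].
  move=> m; apply: (prob_large_occupancy p0 balls) => u.
  by apply: (le_trans (hD u)); rewrite size_tuple -mulrN opprB addrC.
have : {ae P, forall t, \forall m \near \oo, ~ B m t}.
  apply: borel_cantelli_ae; first by move=> m; have [] := hB m.
  near=> m; have [_ PB _] := hB m; apply: (le_trans PB); rewrite lee_fin hX//.
  by near: m; exact: near_ln_ge.
apply: filterS => t hBt; near=> m.
have Bmt : ~ B m t by near: m.
have x0 : 0 <= ln m%:R :> R by near: m; exact: near_ln_ge.
apply: (@le_trans _ _ ((n m)%:R)%:E).
  apply: H_le => u; have [_ _ /(_ t Bmt u)] := hB m.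
  rewrite ltNge; apply: contraTN => h; rewrite -leqNgt /j.
  by rewrite -(ler_nat R); apply: le_trans h; rewrite truncn_le powR_ge0.
rewrite lee_fin /n -natr1 lerD2r truncn_le mulr_ge0//.
exact: ltW.
Unshelve. all: by end_near. Qed.

Lemma H_lower_ae (eta : R) :
  (forall e, 0 < e -> exists2 D, 0 < D & forall n, exists u : n.-tuple 'I_K,
      D * expR (n%:R * (- kappa - e)) <= box_size p root u) ->
  0 < eta -> eta < (1 - alpha) / kappa ->
  {ae P, forall t, \forall m \near \oo,
    ((((1 - alpha) / kappa - eta) * ln (m%:R : R) - 1)%:E <=
      H fall m ((m%:R : R) `^ alpha) t)%E}.
Proof.
move=> lower eta0 eta1; pose a := (1 - alpha) / kappa - eta.
have a0 : 0 < a by rewrite subr_gt0.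
pose e := eta * kappa / (2 * a).
have e0 : 0 < e by rewrite !(divr_gt0, mulr_gt0).
have [D D0 hD] := lower e e0.
have w0 : 0 <= kappa + e by rewrite addr_ge0// ltW.
have aw : a * (kappa + e) = 1 - alpha - eta * kappa / 2.
  have -> : a * (kappa + e) = a * kappa + eta * kappa / 2.
    by rewrite /e; field; rewrite gt_eqF.
  by rewrite /a; field; rewrite gt_eqF.
have dl0 : 0 < eta * kappa / 2 by rewrite !(divr_gt0, mulr_gt0).
have [X hX] := small_occupancy_estimate _ _ _ _ _ (ltW a0) w0 alpha_gt0 alpha_lt1 dl0 D0 aw.
pose n m := Num.truncn (a * ln (m%:R : R)).
(* Rounding up: [j m] balls exceed [m^alpha], so the box prevents its generation from qualifying. *)
pose j m := (Num.truncn ((m%:R : R) `^ alpha)).+1.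
have /choice[B hB] : forall m, exists B, exists2 u : (n m).-tuple 'I_K,
    D * expR (- ((n m)%:R * (kappa + e))) <= box_size p root u &
    [/\ measurable B, (P B <= ((j m)%:R * (1 - box_size p root u) ^+ (m %/ j m))%:E)%E &
    forall t, ~ B t -> (j m <= occupancy fall m (n m) u t)%N].
  move=> m; have [u hu] := hD (n m).
  have [B hB] := prob_small_occupancy balls m (n m) (j m) u.
  exists B, u => //; apply: le_trans hu.
  by rewrite -mulrN opprD.
have : {ae P, forall t, \forall m \near \oo, ~ B m t}.
  apply: borel_cantelli_ae; first by move=> m; have [u _ []] := hB m.
  near=> m; have [u hu [_ PB _]] := hB m; apply: (le_trans PB); rewrite lee_fin.
  apply: (hX _ (n m)) => //; first by near: m; exact: near_ln_ge.
  exact: (box_size_prob_le1 balls).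
apply: filterS => t hBt; near=> m.
have Bmt : ~ B m t by near: m.
have [u hu [_ _ /(_ t Bmt) occ]] := hB m.
apply: (@le_trans _ _ ((n m)%:R)%:E).
  by rewrite lee_fin lerBlDr natr1 ltW// truncnS_gt.
apply: (@H_ge _ _ _ _ _ _ _ u); apply: (@le_trans _ _ (j m)%:R).
  by rewrite ltW// truncnS_gt.
by rewrite ler_nat.
Unshelve. all: by end_near. Qed.

End Sandwich.

Theorem theorem2 (R : realType) (K : nat) (hK : (2 <= K)%N) (p : 'M[R]_K)
    (p_stochastic : stochastic p)
    (p_irreducible : irreducible_chain p)
    (p_aperiodic : aperiodic_chain p)
    (alpha : R) (alpha_gt0 : 0 < alpha) (alpha_lt1 : alpha < 1)
    (d : measure_display) (T : measurableType d) (P : probability T R)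
    (fall : nat -> nat -> T -> 'I_K)
    (balls : ball_process P p (Ordinal (ltnW hK)) fall) :
  exists Cstar : R,
    (rho p theta / - derive1 (rho p) theta @[theta --> +oo] --> Cstar) /\
    {ae P, forall t,
      ((ln (m%:R : R))^-1%:E * H fall m ((m%:R : R) `^ alpha) t)%E
        @[m --> \oo] --> ((1 - alpha) * Cstar)%:E}.
Proof.
have [gam [gam0 C_cvg upper lower]] :=
  box_growth_rate hK p_stochastic p_irreducible p_aperiodic.
have [p0 _] := p_stochastic.
exists (- gam^-1); split => //.
pose kappa := - gam; have kappa0 : 0 < kappa by rewrite oppr_gt0.
pose a := (1 - alpha) / kappa.
have a0 : 0 < a by rewrite divr_gt0// subr_gt0.
have aE : (1 - alpha) * - gam^-1 = a by rewrite /a /kappa invrN.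
(* A countable sequence of margins, so that the almost sure events can be intersected; [k.+2] keeps
   [eta k] below [a], as the lower bound requires. *)
rewrite aE; pose eta (k : nat) := a / k.+2%:R.
have eta0 k : 0 < eta k by rewrite divr_gt0.
have eta1 k : eta k < a.
  by rewrite /eta ltr_pdivrMr ?ltr0n// ltr_pMr// ltr1n.
have hup : {ae P, forall t, forall k, \forall m \near \oo,
    (H fall m ((m%:R : R) `^ alpha) t <= ((a + eta k) * ln (m%:R : R) + 1)%:E)%E}.
  apply/ae_foralln => k; apply: (H_upper_ae p0 balls) => //.
  move=> e e0; have [D D0 hD] := upper e e0; exists D => // u.
  by rewrite /kappa opprK.
have hlow : {ae P, forall t, forall k, \forall m \near \oo,
    (((a - eta k) * ln (m%:R : R) - 1)%:E <= H fall m ((m%:R : R) `^ alpha) t)%E}.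
  apply/ae_foralln => k; apply: (H_lower_ae balls) => //.
  move=> e e0; have [D D0 hD] := lower e e0; exists D => // n.
  by have [u hu] := hD (Ordinal (ltnW hK)) n; exists u; rewrite /kappa opprK.
move: hup hlow; apply: filterS2 => t up low.
(* The two bounds with [k = 0] exclude infinite values for large [m], which reduces the limit to
   real numbers. *)
have fin : \forall m \near \oo, H fall m ((m%:R : R) `^ alpha) t \is a fin_num.
  near=> m; apply/fin_numP; split; apply/eqP => Hoo.
    have : (((a - eta 0%N) * ln (m%:R : R) - 1)%:E <= H fall m ((m%:R : R) `^ alpha) t)%E.
      by near: m; exact: low.
    by rewrite Hoo leeNy_eq.
  have : (H fall m ((m%:R : R) `^ alpha) t <= ((a + eta 0%N) * ln (m%:R : R) + 1)%:E)%E.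
    by near: m; exact: up.
  by rewrite Hoo leye_eq.
apply/fine_cvgP; split.
  near=> m; rewrite fin_numM//; near: m; exact: fin.
apply/cvgrPdist_le => e e0.
have [k hk] : exists k, eta k <= e / 2.
  exists (Num.truncn (a / (e / 2))); rewrite /eta ler_pdivrMr ?ltr0n//.
  rewrite mulrC -ler_pdivrMr ?divr_gt0//.
  apply: ltW; apply: (lt_trans (truncnS_gt _)); rewrite ltr_nat//.
near=> m.
have finm : H fall m ((m%:R : R) `^ alpha) t \is a fin_num by near: m.
have upm : (H fall m ((m%:R : R) `^ alpha) t <= ((a + eta k) * ln (m%:R : R) + 1)%:E)%E.
  by near: m; exact: up.
have lowm : (((a - eta k) * ln (m%:R : R) - 1)%:E <= H fall m ((m%:R : R) `^ alpha) t)%E.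
  by near: m; exact: low.
(* This makes the additive constants 1 at most [e / 2 * ln m]; the margin [eta k] accounts for the
   other half of [e]. *)
have x2 : 2 / e <= ln (m%:R : R) by near: m; exact: near_ln_ge.
have x0 : 0 < ln (m%:R : R) by apply: lt_le_trans x2; rewrite divr_gt0.
move: upm lowm; rewrite /= fineM// -(fineK finm) !lee_fin fineK//.
set h := fine _; set x := ln _ in x0 x2 *; move=> upm lowm.
have xe : 1 <= e / 2 * x.
  by move: x2; rewrite ler_pdivrMr//; lra.
have ek : eta k * x <= e / 2 * x by rewrite ler_pM2r.
have -> : a - fine x^-1%:E * h = (a * x - h) / x.
  by rewrite /=; field; rewrite gt_eqF.
rewrite normrM normfV (gtr0_norm x0) ler_pdivrMr// ler_norml.
by apply/andP; split; lra.
Unshelve. all: by end_near. Qed.
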